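(* Let $p$ be a prime number, let $\xi\in\mathbb{Q}_p$ be transcendental over $\mathbb{Q}$ and let $n \ge 2$ be an integer. Then there exists a positive constant $c=c(n,p,\xi)$ such that the inequality $$|\xi - \alpha|_p \le c \, H(\alpha)^{-\lceil n/2\rceil-1}$$ has infinitely many solutions in $p$-adic algebraic numbers $\alpha$ of degree exactly $n$ and also, if $|\xi|_p = 1$, infinitely many solutions in $p$-adic algebraic integers $\alpha$ of degree exactly $n+1$.
   Context: $|\cdot|_p$ is the usual $p$-adic absolute value on $\mathbb{Q}_p$, normalized by $|p|_p=p^{-1}$, and $\lceil\cdot\rceil$ is the ceiling function. A $p$-adic algebraic number is an element $\alpha\in\mathbb{Q}_p$ algebraic over $\mathbb{Q}$; it is a $p$-adic algebraic integer if it is in addition a root of a monic polynomial with integer coefficients; its degree is its degree over $\mathbb{Q}$. The height $H(P)$ of an integer polynomial $P$ is the maximum of the absolute values of its coefficients, and the height $H(\alpha)$ of a $p$-adic algebraic number $\alpha$ is the height of its minimal defining polynomial over $\mathbb{Z}$ with coprime coefficients. *)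

(* Defs.v *)
From HB Require Import structures.
From mathcomp Require Import all_boot all_order all_algebra.
From mathcomp Require Import all_classical all_reals all_analysis.
From mathcomp Require Import generic_quotient ring_quotient.

Set Implicit Arguments.
Unset Strict Implicit.
Unset Printing Implicit Defensive.

Import Order.TTheory GRing.Theory Num.Theory.
Import numFieldNormedType.Exports.

Local Open Scope classical_set_scope.
Local Open Scope ring_scope.

(* [numq q] and [denq q] are coprime, so one of the two factors is 1. *)
Definition padic_norm (p : nat) (q : rat) : rat :=
  if q == 0 then 0
  else p%:R ^+ logn p `|denq q| / p%:R ^+ logn p `|numq q|.

Section PadicNorm.
Variables (p : nat) (p_pr : prime p).
Local Notation N := (padic_norm p).
Implicit Types x y : rat.

Let p_gt0 : 0 < p%:R :> rat. Proof. by rewrite ltr0n prime_gt0. Qed.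
Let p_ge1 : 1 <= p%:R :> rat. Proof. by rewrite ler1n prime_gt0. Qed.

Lemma padic_norm0 : N 0 = 0. Proof. by rewrite /padic_norm eqxx. Qed.

Lemma padic_norm_frac (a b : int) : a != 0 -> b != 0 ->
  N (a%:~R / b%:~R) = p%:R ^+ logn p `|b| / p%:R ^+ logn p `|a|.
Proof.
move=> a0 b0; set q := a%:~R / b%:~R.
have bQ : b%:~R != 0 :> rat by rewrite intr_eq0.
have q0 : q != 0 by rewrite mulf_neq0 ?invr_eq0 ?intr_eq0.
rewrite /padic_norm (negPf q0).
have e : (a * denq q = numq q * b).
  apply: (@intr_inj rat); rewrite !intrM.
  have := divq_num_den q; rewrite {3}/q => /eqP.
  by rewrite GRing.eqr_div ?intr_eq0 ?denq_neq0 // => /eqP ->.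
have /= el := congr1 (logn p \o absz) e; move: el.
rewrite !abszM !lognM ?absz_gt0 ?numq_eq0 ?denq_neq0 // => el.
have pn n : p%:R ^+ n != 0 :> rat by rewrite expf_neq0 // gt_eqF.
by apply/eqP; rewrite GRing.eqr_div // -!exprD addnC el addnC.
Qed.

Lemma padic_norm_ge0 x : 0 <= N x.
Proof.
by rewrite /padic_norm; case: ifP => // _; rewrite divr_ge0 ?exprn_ge0 ?ltW.
Qed.

Lemma padic_norm_eq0 x : (N x == 0) = (x == 0).
Proof.
rewrite /padic_norm; case: ifP => [|_]; first by rewrite eqxx.
by apply/negbTE; rewrite mulf_neq0 ?invr_eq0 ?expf_neq0 ?gt_eqF.
Qed.

Lemma padic_normM x y : N (x * y) = N x * N y.
Proof.
have [->|x0] := eqVneq x 0; first by rewrite mul0r padic_norm0 mul0r.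
have [->|y0] := eqVneq y 0; first by rewrite mulr0 padic_norm0 mulr0.
rewrite -[in LHS](divq_num_den x) -[in LHS](divq_num_den y) mulf_div -!intrM.
rewrite padic_norm_frac ?mulf_neq0 ?numq_eq0 ?denq_neq0 //.
rewrite /padic_norm (negPf x0) (negPf y0) !abszM.
by rewrite !lognM ?absz_gt0 ?numq_eq0 ?denq_neq0 // !exprD mulf_div.
Qed.

Lemma padic_norm1 : N 1 = 1.
Proof. by rewrite /padic_norm oner_eq0 !logn1 divr1. Qed.

Lemma padic_normN x : N (- x) = N x.
Proof.
rewrite -mulN1r padic_normM -[RHS]mul1r; congr (_ * _).
have <- : (-1)%:~R / 1%:~R = -1 :> rat by rewrite divr1.
by rewrite padic_norm_frac //= logn1 divr1.
Qed.

Lemma padic_normB x y : N (x - y) = N (y - x).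
Proof. by rewrite -padic_normN opprB. Qed.

Lemma padic_normV x : N x^-1 = (N x)^-1.
Proof.
have [->|x0] := eqVneq x 0; first by rewrite !(invr0, padic_norm0).
have Nx : N x != 0 by rewrite padic_norm_eq0.
by apply: (mulfI Nx); rewrite -padic_normM !divff ?padic_norm1.
Qed.

Lemma padic_norm_p : N p%:R = p%:R^-1.
Proof.
have p0 : p%:Z != 0 by rewrite eqz_nat -lt0n prime_gt0.
have {1}<- : (p%:Z)%:~R / 1%:~R = p%:R :> rat by rewrite divr1.
by rewrite padic_norm_frac //= logn1 logn_prime // eqxx expr0 expr1 div1r.
Qed.

Lemma padic_norm_ultra x y : N (x + y) <= Num.max (N x) (N y).
Proof.
have [->|x0] := eqVneq x 0; first by rewrite add0r le_max lexx orbT.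
have [->|y0] := eqVneq y 0; first by rewrite addr0 le_max lexx.
have [->|s0] := eqVneq (x + y) 0.
  by rewrite padic_norm0 le_max padic_norm_ge0.
pose a := numq x * denq y; pose b := numq y * denq x; pose d := denq x * denq y.
have d0 : d != 0 by rewrite mulf_neq0 ?denq_neq0.
have dQ : d%:~R != 0 :> rat by rewrite intr_eq0.
have a0 : a != 0 by rewrite mulf_neq0 ?denq_neq0 ?numq_eq0.
have b0 : b != 0 by rewrite mulf_neq0 ?denq_neq0 ?numq_eq0.
have ex : x = a%:~R / d%:~R.
  rewrite !intrM -mulf_div divq_num_den divff ?mulr1 //.
  by rewrite intr_eq0 denq_neq0.
have ey : y = b%:~R / d%:~R.
  rewrite !intrM [X in _ / X]mulrC -mulf_div divq_num_den divff ?mulr1 //.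
  by rewrite intr_eq0 denq_neq0.
have es : x + y = (a + b)%:~R / d%:~R by rewrite {1}ex ey -mulrDl intrD.
have ab0 : a + b != 0.
  by apply: contraNneq s0 => ab0; rewrite es ab0 mul0r.
rewrite es ex ey !padic_norm_frac // le_max.
have pp n : 0 < p%:R ^+ n :> rat by rewrite exprn_gt0.
rewrite !ler_pM2l // !lef_pV2 ?posrE // !ler_eXn2l ?ltr1n ?prime_gt1 //.
set m := minn (logn p `|a|) (logn p `|b|).
suff H : (m <= logn p `|(a + b)%R|)%N.
  by rewrite -geq_min.
rewrite -pfactor_dvdn ?absz_gt0 //.
have: (Posz (p ^ m)%N %| a + b)%Z.
  apply: rpredD; rewrite dvdzE /= pfactor_dvdn ?absz_gt0 //.
    exact: geq_minl.
  exact: geq_minr.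
by rewrite dvdzE.
Qed.

Lemma padic_norm_ltD x y e : N x < e -> N y < e -> N (x + y) < e.
Proof.
by move=> xe ye; apply: le_lt_trans (padic_norm_ultra x y) _; rewrite gt_max xe.
Qed.

Lemma padic_norm_isosceles x y : N (x - y) < N y -> N x = N y.
Proof.
move=> h; apply/le_anti/andP; split.
  by have := padic_norm_ultra (x - y) y; rewrite subrK (max_r (ltW h)).
rewrite leNgt; apply/negP => xy.
have := @padic_norm_ltD (y - x) x (N y); rewrite subrK ltxx padic_normB.
by move=> /(_ h xy).
Qed.

End PadicNorm.

Definition padic_cauchy (p : nat) (x : nat -> rat) : Prop :=
  forall e : rat, 0 < e -> exists K : nat, forall m n : nat,
    (K <= m)%N -> (K <= n)%N -> padic_norm p (x m - x n) < e.

Definition padic_null (p : nat) (x : nat -> rat) : Prop :=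
  forall e : rat, 0 < e -> exists K : nat, forall n : nat,
    (K <= n)%N -> padic_norm p (x n) < e.

(* [p_pr] is a phantom parameter here: it lets the ring structure below be
   inferred from the type. *)
Definition padic_cauchy_pred (p : nat) (p_pr : prime p) : {pred nat -> rat} :=
  fun x => `[< padic_cauchy p x >].

Record cauchy_seq (p : nat) (p_pr : prime p) := CauchySeq {
  cauchy_val :> nat -> rat;
  cauchy_valP : cauchy_val \in padic_cauchy_pred p_pr }.

Section CauchyRing.
Variables (p : nat) (p_pr : prime p).
Local Notation N := (padic_norm p).
Local Notation cauchy_seq := (cauchy_seq p_pr).

Lemma padic_cauchy_bounded x : padic_cauchy p x ->
  exists2 B : rat, 0 < B & forall n, N (x n) <= B.
Proof.
move=> /(_ 1 ltr01)[K hK].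
pose B := 1 + N (x K) + \sum_(i < K) N (x i).
have s0 : 0 <= \sum_(i < K) N (x i).
  by apply: sumr_ge0 => i _; apply: padic_norm_ge0.
exists B => [|n].
  by rewrite /B -addrA ltr_pwDl // addr_ge0 // padic_norm_ge0.
have [nK|Kn] := ltnP n K.
  rewrite /B (bigD1 (Ordinal nK)) //= addrCA lerDl.
  rewrite !addr_ge0 ?padic_norm_ge0 //.
  by apply: sumr_ge0 => i _; apply: padic_norm_ge0.
have := padic_norm_ultra p_pr (x n - x K) (x K); rewrite subrK.
move=> /le_trans; apply; rewrite ge_max; apply/andP; split.
  apply: le_trans (ltW (hK _ _ Kn (leqnn _))) _.
  by rewrite /B -addrA lerDl addr_ge0 ?padic_norm_ge0.
by rewrite /B addrAC lerDr addr_ge0.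
Qed.

Lemma padic_cauchy_subring : subring_closed (padic_cauchy_pred p_pr).
Proof.
split=> [|x y /asboolP cx /asboolP cy|x y /asboolP cx /asboolP cy].
- apply/asboolP => e e0; exists 0%N => m n _ _.
  by rewrite subrr padic_norm0.
- apply/asboolP => e e0; have [K hK] := cx e e0; have [L hL] := cy e e0.
  exists (maxn K L) => m n; rewrite !geq_max => /andP[Km Lm] /andP[Kn Ln].
  rewrite (_ : (x - y) m - (x - y) n = (x m - x n) - (y m - y n)); last first.
    by rewrite !fctE opprD opprK addrACA !opprD opprK.
  by rewrite padic_norm_ltD // ?hK // padic_normN // hL.
- apply/asboolP => e e0.
  have [A A0 hA] := padic_cauchy_bounded cx.
  have [B B0 hB] := padic_cauchy_bounded cy.
  have [K hK] := cx (e / B) (divr_gt0 e0 B0).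
  have [L hL] := cy (e / A) (divr_gt0 e0 A0).
  exists (maxn K L) => m n; rewrite !geq_max => /andP[Km Lm] /andP[Kn Ln].
  rewrite (_ : (x * y) m - (x * y) n
             = (x m - x n) * y m + x n * (y m - y n)); last first.
    by rewrite !fctE mulrBl mulrBr addrA subrK.
  apply: padic_norm_ltD => //; rewrite padic_normM //.
    apply: le_lt_trans (ler_wpM2l (padic_norm_ge0 p _) (hB m)) _.
    by rewrite -ltr_pdivlMr // hK.
  apply: le_lt_trans (ler_wpM2r (padic_norm_ge0 p _) (hA n)) _.
  by rewrite mulrC -ltr_pdivlMr // hL.
Qed.

HB.instance Definition _ :=
  GRing.isSubringClosed.Build _ (padic_cauchy_pred p_pr) padic_cauchy_subring.

HB.instance Definition _ := [isSub for @cauchy_val p p_pr].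
HB.instance Definition _ := [Choice of cauchy_seq by <:].
HB.instance Definition _ := [SubChoice_isSubComNzRing of cauchy_seq by <:].

Definition padic_null_pred : {pred cauchy_seq} :=
  fun x => `[< padic_null p x >].

Lemma padic_null_idealr : idealr_closed padic_null_pred.
Proof.
split.
- by apply/asboolP => e e0; exists 0%N => n _; rewrite padic_norm0.
- apply/negP => /asboolP /(_ 1 ltr01)[K /(_ K (leqnn K))].
  by rewrite padic_norm1 ltxx.
- move=> a x y /asboolP nx /asboolP ny; apply/asboolP => e e0.
  have /asboolP ca := cauchy_valP a.
  have [A A0 hA] := padic_cauchy_bounded ca.
  have [K hK] := nx (e / A) (divr_gt0 e0 A0).
  have [L hL] := ny e e0.
  exists (maxn K L) => n; rewrite !geq_max => /andP[Kn Ln].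
  apply: padic_norm_ltD => //; last exact: hL.
  rewrite padic_normM //.
  apply: le_lt_trans (ler_wpM2r (padic_norm_ge0 p _) (hA n)) _.
  by rewrite mulrC -ltr_pdivlMr // hK.
Qed.

HB.instance Definition _ :=
  isIdealr.Build _ padic_null_pred padic_null_idealr.

(* The completion of the rationals for the p-adic absolute value: Cauchy
   sequences modulo null sequences. *)
Definition padic := {ideal_quot padic_null_pred}.

HB.instance Definition _ := GRing.ComNzRing.on padic.
HB.instance Definition _ := EqQuotient.on padic.

Definition padic_of (x : cauchy_seq) : padic := (\pi_padic x)%qT.

Lemma padic_ofP (z : padic) : padic_of (repr z) = z.
Proof. exact: reprK. Qed.

Lemma padic_of_eq (x y : cauchy_seq) :
  padic_of x = padic_of y <-> padic_null p (x - y).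
Proof.
split=> [/eqP|h]; last apply/eqP; rewrite /padic_of -Quotient.idealrBE.
  by move=> /asboolP.
exact/asboolP.
Qed.

Lemma padic_of_is_zmod_morphism : zmod_morphism padic_of.
Proof. by move=> x y; rewrite /padic_of rmorphB. Qed.
Lemma padic_of_is_monoid_morphism : monoid_morphism padic_of.
Proof. by split=> [|x y]; rewrite /padic_of ?rmorph1 ?rmorphM. Qed.
HB.instance Definition _ :=
  GRing.isZmodMorphism.Build _ _ padic_of padic_of_is_zmod_morphism.
HB.instance Definition _ :=
  GRing.isMonoidMorphism.Build _ _ padic_of padic_of_is_monoid_morphism.

Lemma padic_of_eq0 (x : cauchy_seq) : padic_of x = 0 <-> padic_null p x.
Proof. by rewrite -(rmorph0 padic_of) padic_of_eq subr0. Qed.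

Lemma padic_norm_eventually (x : nat -> rat) :
  padic_cauchy p x -> ~ padic_null p x ->
  exists2 r : rat, 0 < r &
    exists K : nat, forall n, (K <= n)%N -> N (x n) = r.
Proof.
move=> cx nx.
have [e e0 he] : exists2 e : rat, 0 < e &
    forall K, exists2 n, (K <= n)%N & e <= N (x n).
  apply: contrapT => H; apply: nx => e e0; apply: contrapT => H2; apply: H.
  exists e => // K; apply: contrapT => H3; apply: H2; exists K => n Kn.
  by rewrite ltNge; apply/negP => en; apply: H3; exists n.
have [K hK] := cx e e0; have [m Km em] := he K.
exists (N (x m)); first exact: lt_le_trans em.
exists K => n Kn; apply: padic_norm_isosceles => //.
exact: lt_le_trans (hK _ _ Kn Km) em.
Qed.

Lemma padic_cauchyV (x : nat -> rat) :
  padic_cauchy p x -> ~ padic_null p x ->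
  padic_cauchy p (fun n => (x n)^-1).
Proof.
move=> cx nx e e0; have [r r0 [K hK]] := padic_norm_eventually cx nx.
have [L hL] := cx (e * r ^+ 2) (mulr_gt0 e0 (exprn_gt0 2 r0)).
exists (maxn K L) => m n; rewrite !geq_max => /andP[Km Lm] /andP[Kn Ln].
have x0 k : (K <= k)%N -> x k != 0.
  by move=> /hK xk; rewrite -(padic_norm_eq0 p_pr) xk gt_eqF.
have -> : (x m)^-1 - (x n)^-1 = (x n - x m) / (x m * x n).
  rewrite mulrBl invfM mulrCA divff ?x0 // mulr1.
  by rewrite mulrA divff ?x0 // mul1r.
rewrite padic_normM // padic_normV // padic_normM // !hK //.
by rewrite ltr_pdivrMr ?mulr_gt0 // hL.
Qed.

Definition padic_inv (z : padic) : padic :=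
  if z == 0 then 0
  else padic_of (insubd (0 : cauchy_seq) (fun n => (repr z n)^-1)).

Lemma padic_mulVf (z : padic) : z != 0 -> padic_inv z * z = 1.
Proof.
move=> z0; rewrite /padic_inv (negPf z0); set x := repr z.
have cx : padic_cauchy p x by apply/asboolP; exact: cauchy_valP.
have nx : ~ padic_null p x.
  by move=> /padic_of_eq0; rewrite padic_ofP; apply/eqP.
rewrite -[X in _ * X = _]padic_ofP -/x -rmorphM -(rmorph1 padic_of).
apply/padic_of_eq => e e0.
have [r r0 [K hK]] := padic_norm_eventually cx nx.
exists K => n Kn.
have xV : (fun n => (x n)^-1) \in (padic_cauchy_pred p_pr).
  exact/asboolP/padic_cauchyV.
have /(congr1 (@^~ n)) E := insubdK (0 : cauchy_seq) xV.
rewrite [X in N X](_ : _ = (x n)^-1 * x n - 1); last by rewrite -[in RHS]E.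
rewrite mulVf ?subrr ?padic_norm0 //.
by rewrite -(padic_norm_eq0 p_pr) hK // gt_eqF.
Qed.

Lemma padic_inv0 : padic_inv 0 = 0.
Proof. by rewrite /padic_inv eqxx. Qed.

HB.instance Definition _ :=
  GRing.ComNzRing_isField.Build padic padic_mulVf padic_inv0.

End CauchyRing.
Arguments padic {p} p_pr.

Section PadicRat.
Variables (p : nat) (p_pr : prime p).

Lemma padic_cst_cauchy (q : rat) :
  (fun=> q : rat) \in padic_cauchy_pred p_pr.
Proof. by apply/asboolP => e e0; exists 0%N => *; rewrite subrr padic_norm0. Qed.

Definition padic_rat (q : rat) : padic p_pr :=
  padic_of (CauchySeq (padic_cst_cauchy q)).

Lemma padic_rat_is_zmod_morphism : zmod_morphism padic_rat.
Proof.
by move=> a b; rewrite -rmorphB /padic_rat; congr padic_of; apply: val_inj.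
Qed.
Lemma padic_rat_is_monoid_morphism : monoid_morphism padic_rat.
Proof.
split; first by rewrite -(rmorph1 (@padic_of p p_pr)); congr padic_of; apply: val_inj.
by move=> a b; rewrite -rmorphM /padic_rat; congr padic_of; apply: val_inj.
Qed.
HB.instance Definition _ :=
  GRing.isZmodMorphism.Build _ _ padic_rat padic_rat_is_zmod_morphism.
HB.instance Definition _ :=
  GRing.isMonoidMorphism.Build _ _ padic_rat padic_rat_is_monoid_morphism.

Lemma padic_ratE (q : rat) : padic_rat q = ratr q.
Proof. by rewrite -[in LHS](divq_num_den q) fmorph_div !rmorph_int. Qed.

End PadicRat.

Section PadicAbs.
Variables (R : realType) (p : nat) (p_pr : prime p).
Local Notation N := (padic_norm p).
Local Notation Qp := (padic p_pr).
Implicit Types x y z : Qp.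

(* The limit does not depend on the representative: see [padic_abs_cvg]. *)
Definition padic_abs (z : Qp) : R :=
  limn (fun n => ratr (N (repr z n)) : R).

Let nR (x : nat -> rat) : R^nat := fun n => ratr (N (x n)).

Let nR_null (x : nat -> rat) : padic_null p x <-> (nR x @ \oo --> (0 : R)).
Proof.
split=> [nx|/cvgrPdist_lt nx e e0].
  apply/cvgrPdist_lt => e e0.
  have [q] := rat_in_itvoo e0; rewrite in_itv /= => /andP[q0 qe].
  have [K hK] := nx q (eq_ind _ is_true q0 _ (ltr0q R q)).
  exists K => // n /= /hK h; rewrite sub0r normrN ger0_norm ?ler0q ?padic_norm_ge0 //.
  by apply: lt_trans qe; rewrite /nR ltr_rat.
have [|K _ hK] := nx (ratr e); first by rewrite ltr0q.
exists K => n /hK; rewrite sub0r normrN ger0_norm ?ler0q ?padic_norm_ge0 //.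
by rewrite ltr_rat.
Qed.

Let nR_dist (x y : nat -> rat) n : `|nR x n - nR y n| <= nR (fun n => x n - y n) n.
Proof.
rewrite /nR -rmorphB /= -ratr_norm ler_rat.
have tri a b : N a <= N b + N (a - b).
  have := padic_norm_ultra p_pr b (a - b); rewrite addrC subrK => /le_trans; apply.
  by rewrite ge_max lerDl lerDr !padic_norm_ge0.
rewrite ler_norml lerNl opprB; apply/andP; split; rewrite lerBlDl //.
by rewrite padic_normB.
Qed.

Let nR_cvg (x : nat -> rat) : padic_cauchy p x -> cvgn (nR x).
Proof.
move=> cx; have [nx|nx] := pselect (padic_null p x).
  by apply/cvg_ex; exists 0; apply/nR_null.
have [r _ [K hK]] := padic_norm_eventually p_pr cx nx.
apply/cvg_ex; exists (ratr r); apply: cvg_near_cst.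
by exists K => // n /= /hK e; rewrite /nR e.
Qed.

Lemma padic_abs_cvg (x : cauchy_seq p_pr) :
  ratr (N (x n)) @[n --> \oo] --> padic_abs (padic_of x).
Proof.
set z := padic_of _.
have cz : padic_cauchy p (repr z) by apply/asboolP; exact: cauchy_valP.
have nz : nR (fun n => x n - repr z n) @ \oo --> (0 : R).
  apply: (nR_null _).1; have := (padic_of_eq x (repr z)).1; apply.
  by rewrite padic_ofP.
rewrite -[padic_abs z]add0r.
have -> : (fun n => ratr (N (x n)) : R) =
    (fun n => (nR x n - nR (repr z) n) + nR (repr z) n).
  by apply/funext => n; rewrite subrK.
apply: cvgD; last exact: nR_cvg.
apply/norm_cvg0P.
apply: (squeeze_cvgr _ (cvg_cst 0) nz).
by near=> n; rewrite normr_ge0 nR_dist.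
Unshelve. all: by end_near. Qed.

Lemma padic_abs_le (x : cauchy_seq p_pr) (a : R) :
  (\forall n \near \oo, ratr (N (x n)) <= a) ->
  padic_abs (padic_of x) <= a.
Proof. by have h := @padic_abs_cvg x; move=> /(cvgr_to_le h). Qed.

Lemma padic_abs_rat (q : rat) : padic_abs (padic_rat p_pr q) = ratr (N q).
Proof.
have h := @padic_abs_cvg (CauchySeq (padic_cst_cauchy p_pr q)).
have c : ratr (N q) @[_ --> \oo] --> (ratr (N q) : R) by exact: cvg_cst.
exact: norm_cvg_unique h c.
Qed.

Lemma padic_abs_ge0 z : 0 <= padic_abs z.
Proof.
rewrite -[z]padic_ofP; have h := @padic_abs_cvg (repr z).
apply: (cvgr_to_ge h).
by near=> n; rewrite ler0q padic_norm_ge0.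
Unshelve. all: by end_near. Qed.

Lemma padic_abs_eq0 z : (padic_abs z == 0) = (z == 0).
Proof.
apply/eqP/eqP => [z0|->]; last first.
  by rewrite -(rmorph0 (padic_rat p_pr)) padic_abs_rat padic_norm0 rmorph0.
rewrite -[z]padic_ofP; apply/padic_of_eq0/nR_null.
by rewrite -z0 -[in padic_abs z](padic_ofP z); exact: padic_abs_cvg.
Qed.

Lemma padic_absM x y : padic_abs (x * y) = padic_abs x * padic_abs y.
Proof.
rewrite -[x]padic_ofP -[y]padic_ofP -rmorphM.
have hM := @padic_abs_cvg (repr x * repr y).
apply: (norm_cvg_unique hM).
rewrite (_ : (fun n => ratr (N ((repr x * repr y) n)) : R) =
    (fun n => nR (repr x) n * nR (repr y) n)); last first.
  by apply/funext => n; rewrite /nR -rmorphM -padic_normM.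
by apply: cvgM; exact: padic_abs_cvg.
Qed.

Lemma padic_abs_ultra x y :
  padic_abs (x + y) <= Num.max (padic_abs x) (padic_abs y).
Proof.
rewrite -[x]padic_ofP -[y]padic_ofP -rmorphD.
have cv : Num.max (nR (repr x) n) (nR (repr y) n) @[n --> \oo] -->
    Num.max (padic_abs (padic_of (repr x)))
            (padic_abs (padic_of (repr y))).
  have mE (a b : R) : Num.max a b = (a + b + `|a - b|) / 2 by exact: maxr_absE.
  have mF : (fun n => Num.max (nR (repr x) n) (nR (repr y) n)) = (fun n =>
      (nR (repr x) n + nR (repr y) n + `|nR (repr x) n - nR (repr y) n|) / 2).
    by apply/funext => n; exact: mE.
  rewrite mE mF.
  have cx : nR (repr x) n @[n --> \oo] --> padic_abs (padic_of (repr x)).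
    exact: padic_abs_cvg.
  have cy : nR (repr y) n @[n --> \oo] --> padic_abs (padic_of (repr y)).
    exact: padic_abs_cvg.
  apply: cvgM; last exact: cvg_cst.
  apply: cvgD; first exact: cvgD.
  by apply: cvg_norm; apply: cvgB.
have h := @padic_abs_cvg (repr x + repr y); apply: (ler_cvg_to h cv).
near=> n; apply: (@le_trans _ _ (ratr (Num.max (N (repr x n)) (N (repr y n))))).
  by rewrite ler_rat padic_norm_ultra.
by rewrite /nR !maxEle ler_rat; case: ifP.
Unshelve. all: by end_near. Qed.

Lemma padic_abs_dense z (e : R) : 0 < e ->
  exists q : rat, padic_abs (z - padic_rat p_pr q) < e.
Proof.
move=> e0.
have [d] := rat_in_itvoo e0; rewrite in_itv /= ltr0q => /andP[d0 de].
have cz : padic_cauchy p (repr z) by apply/asboolP; exact: cauchy_valP.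
have [K hK] := cz d d0; exists (repr z K); apply: le_lt_trans de.
rewrite -{1}[z]padic_ofP -rmorphB.
apply: padic_abs_le.
by exists K => // n /= Kn; rewrite ler_rat ltW // hK.
Qed.

Lemma padic_complete (u : nat -> Qp) :
  (forall e : R, 0 < e -> exists K : nat, forall m n,
     (K <= m)%N -> (K <= n)%N -> padic_abs (u m - u n) < e) ->
  exists l : Qp, padic_abs (u n - l) @[n --> \oo] --> (0 : R).
Proof.
move=> cu.
have absN x : padic_abs (- x) = padic_abs x.
  rewrite -mulN1r padic_absM -(rmorphN1 (padic_rat p_pr)) padic_abs_rat.
  by rewrite padic_normN // padic_norm1 rmorph1 mul1r.
have ltD x y (e : R) : padic_abs x < e -> padic_abs y < e -> padic_abs (x + y) < e.
  by move=> xe ye; apply: le_lt_trans (padic_abs_ultra x y) _; rewrite gt_max xe.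
have q_ n : {q : rat | padic_abs (u n - padic_rat p_pr q) < n.+1%:R^-1}.
  by apply: cid; apply: padic_abs_dense; rewrite invr_gt0.
pose q n := sval (q_ n).
have qP (e : R) : 0 < e -> exists K : nat, forall n, (K <= n)%N ->
    padic_abs (u n - padic_rat p_pr (q n)) < e.
  move=> e0; have [K _ hK] := near_infty_natSinv_lt (PosNum e0).
  by exists K => n /hK /=; apply: lt_trans; exact: (svalP (q_ n)).
have cq : q \in padic_cauchy_pred p_pr.
  apply/asboolP => e e0; have e0R : 0 < ratr e :> R by rewrite ltr0q.
  have [K hK] := cu _ e0R; have [L hL] := qP _ e0R.
  exists (maxn K L) => m n; rewrite !geq_max => /andP[Km Lm] /andP[Kn Ln].
  rewrite -(ltr_rat R) -padic_abs_rat rmorphB.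
  rewrite (_ : _ - _ = - (u m - padic_rat p_pr (q m)) + (u m - u n)
                     + (u n - padic_rat p_pr (q n))).
    by apply: (ltD); [apply: ltD; rewrite ?absN|]; auto.
  by rewrite opprB !subrKA.
exists (padic_of (CauchySeq cq)); apply/cvgrPdist_lt => e e0.
have [d] := rat_in_itvoo e0; rewrite in_itv /= ltr0q => /andP[d0 de].
have d0R : 0 < ratr d :> R by rewrite ltr0q.
have [L hL] := qP _ e0.
have /asboolP/(_ d d0)[K hK] := cq.
exists (maxn K L) => // n /=; rewrite geq_max => /andP[Kn Ln].
rewrite sub0r normrN ger0_norm ?padic_abs_ge0 //.
rewrite -[u n](subrK (padic_rat p_pr (q n))) -addrA; apply: ltD; first exact: hL.
rewrite /padic_rat -rmorphB; apply: le_lt_trans de.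
apply: padic_abs_le.
by exists K => // m /= Km; rewrite ler_rat ltW // hK.
Qed.

End PadicAbs.

Section AlgebraicNumbers.
Variables (p : nat) (p_pr : prime p).
Local Notation Qp := (padic p_pr).
Implicit Types (alpha : Qp).

(* The monic generator of the ideal of rational polynomials vanishing at
   [alpha]. *)
Definition is_minPolyQ alpha (f : {poly rat}) : Prop :=
  f \is monic /\
  forall g : {poly rat}, root (map_poly (padic_rat p_pr) g) alpha = (f %| g).

(* Meaningful for algebraic [alpha]; it is 0 otherwise. *)
Definition minPolyQ alpha : {poly rat} := xget 0 [set f | is_minPolyQ alpha f].

Lemma minPolyQP alpha :
  algebraicOver (padic_rat p_pr) alpha -> is_minPolyQ alpha (minPolyQ alpha).
Proof.
move=> [g g0 rg]; apply: xgetPex.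
have /ex_minnP[m /asboolP[f [f0 rf sf]] hm] : exists m, `[< exists f : {poly rat},
    [/\ f != 0, root (map_poly (padic_rat p_pr) f) alpha & size f = m] >].
  by exists (size g); apply/asboolP; exists g.
have lf0 : lead_coef f != 0 by rewrite lead_coef_eq0.
exists ((lead_coef f)^-1 *: f); split.
  by rewrite monicE lead_coefZ mulVf.
move=> h; rewrite dvdpZl ?invr_eq0 //.
have e : root (map_poly (padic_rat p_pr) h) alpha
       = root (map_poly (padic_rat p_pr) (h %% f)) alpha.
  rewrite {1}(divp_eq h f) rmorphD rmorphM /= !rootE !hornerE.
  by move/rootP: rf => ->; rewrite mulr0 add0r.
rewrite e; apply/idP/idP => [r|/eqP ->]; last by rewrite rmorph0 root0.
apply/negPn/negP => h0.
have: (size (h %% f)%R < m)%N by rewrite -sf ltn_modp.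
by rewrite ltnNge hm //; apply/asboolP; exists (h %% f).
Qed.

Definition alg_degree alpha : nat := (size (minPolyQ alpha)).-1.

(* [zcontents f = 1] says that the coefficients are coprime and that the
   leading one is positive. *)
Definition minPolyZ alpha : {poly int} :=
  xget 0 [set f : {poly int} |
    zcontents f = 1 /\ map_poly intr f %= minPolyQ alpha].

Lemma minPolyZP alpha : algebraicOver (padic_rat p_pr) alpha ->
  zcontents (minPolyZ alpha) = 1 /\
  map_poly intr (minPolyZ alpha) %= minPolyQ alpha.
Proof.
move=> /minPolyQP [mon _].
apply: (@xgetPex _ 0 [set f : {poly int} |
  zcontents f = 1 /\ map_poly intr f %= minPolyQ alpha]).
have [f [a a0 e]] := rat_poly_scale (minPolyQ alpha).
have f0 : f != 0.
  apply: contraTneq mon => f0.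
  by rewrite e f0 rmorph0 scaler0 monicE lead_coef0 eq_sym oner_eq0.
exists (zprimitive f); split; first by rewrite zcontents_primitive f0.
rewrite e (eqp_rtrans (eqp_scale _ _)) ?invr_eq0 ?intr_eq0 //.
rewrite {2}[f]zpolyEprim map_polyZ /=.
by rewrite eqp_sym eqp_scale // intr_eq0 zcontents_eq0.
Qed.

Definition poly_height (f : {poly int}) : nat := \max_(i < size f) `|(f`_i)%R|%N.

Definition alg_height alpha : nat := poly_height (minPolyZ alpha).

End AlgebraicNumbers.

(* Main.v *)
Require Import Defs.
From HB Require Import structures.
From mathcomp Require Import all_boot all_order all_algebra.
From mathcomp Require Import all_classical all_reals all_analysis.
From mathcomp Require Import zify ring lra.

(** Write [w = uphalf n + 1] and, after multiplying [xi] by a power of [p], assume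
    [|xi| <= 1]. The point is to find, for arbitrarily large [X], two coprime integer
    polynomials [P] and [Q] of degree at most [uphalf n], of height at most [X] and of
    value at [xi] at most a constant times [X ^- w] ([coprime_good_pair]). Two such
    polynomials exist for the following reason. Dirichlet's pigeonhole principle gives
    polynomials of degree at most [uphalf n] with [|P(xi)| H(P) ^ w] bounded. Among all
    degrees for which infinitely many primitive polynomials with this property exist,
    take the smallest; since heights are multiplicative up to a constant
    ([height_factors]) and values at [xi] are multiplicative, a reducible polynomial of
    that degree would pass the property on to a factor of smaller degree, so all but
    finitely many are irreducible ([good_irreducible]). Given an irreducible [Q],
    Dirichlet's principle at a scale slightly below [H(Q)] gives a [P] too small to be a
    multiple of [Q].

    Since [2 * uphalf n - 1 <= n], the multiples of [P] and of [Q] span the polynomials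
    of degree at most [n]. Hence every integer polynomial of degree at most [n] is
    congruent, modulo [p q ^ 2] times the lattice generated by these multiples, to one
    of height [O(X)] ([small_representative]). Start from ['X^N + a1 'X + a0], with
    [N = n] or [N = n + 1], where [a0] and [a1] are chosen by congruences: modulo [q ^ 2],
    for an auxiliary prime [q <> p], so that Eisenstein's criterion holds; modulo a
    power of [p], so that the value at [xi] is tiny and the derivative there is a unit.
    Reducing it modulo the lattice preserves these features and yields an
    irreducible [F] of degree [N], monic if [N = n + 1], of height [O(X)], with
    [|F(xi)| = O(X ^- w)] and [|F'(xi)| = 1] ([eisenstein_small_value]). Hensel's lemma
    turns [F] into a root [alpha] with [|xi - alpha| <= |F(xi)|] ([hensel]). These roots
    come arbitrarily close to [xi] without reaching it, so there are infinitely many. *)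

Set Implicit Arguments.
Unset Strict Implicit.
Unset Printing Implicit Defensive.

Import Order.TTheory GRing.Theory Num.Theory.
Import numFieldNormedType.Exports.

Local Open Scope classical_set_scope.
Local Open Scope ring_scope.

(** * Heights of integer polynomials *)

Section Heights.
Implicit Types (P Q A B : {poly int}).

Lemma coef_le_height P i : (`|(P`_i)%R| <= poly_height P)%N.
Proof.
have [lt_iP|le_Pi] := ltnP i (size P); last by rewrite nth_default.
exact: (@leq_bigmax _ (fun i : 'I_(size P) => `|(P`_i)%R|%N) (Ordinal lt_iP)).
Qed.

Lemma height_leP P h : (forall i, (`|(P`_i)%R| <= h)%N) -> (poly_height P <= h)%N.
Proof. by move=> le_h; apply/bigmax_leqP => i _. Qed.

Lemma height_gt0 P : (0 < poly_height P)%N = (P != 0).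
Proof.
apply/idP/idP => [|P0].
  by apply: contraTneq => ->; rewrite -leqNgt; apply: height_leP => i; rewrite coef0.
by apply: leq_trans (coef_le_height P (size P).-1); rewrite absz_gt0 lead_coef_eq0.
Qed.

Lemma heightD P Q : (poly_height (P + Q)%R <= poly_height P + poly_height Q)%N.
Proof.
apply: height_leP => i; rewrite coefD.
by have := coef_le_height P i; have := coef_le_height Q i; lia.
Qed.

Lemma heightZ (c : int) P : c != 0 -> poly_height (c *: P) = (`|c| * poly_height P)%N.
Proof.
move=> c0; rewrite /poly_height size_scale //.
rewrite (big_morph (fun x => `|c| * x)%N (id1 := 0%N) (op1 := maxn)) ?muln0 //.
  by apply: eq_bigr => i _; rewrite coefZ abszM.
by move=> x y; rewrite maxnMr.
Qed.

Lemma absz_sum_le (I : finType) (f : I -> int) :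
  (`|(\sum_i f i)%R| <= \sum_i `|f i|)%N.
Proof.
apply: (big_ind2 (fun (x : int) (y : nat) => (`|x| <= y)%N)) => // x1 y1 x2 y2; lia.
Qed.

Lemma heightM P Q s : (size P <= s)%N ->
  (poly_height (P * Q)%R <= s * poly_height P * poly_height Q)%N.
Proof.
move=> sP; apply: height_leP => i.
rewrite [P](_ : _ = \poly_(j < s) P`_j); last first.
  apply/polyP => j; rewrite coef_poly; case: ltnP => // sj.
  by rewrite nth_default // (leq_trans sP).
rewrite poly_def mulr_suml coef_sum.
apply: leq_trans (absz_sum_le _) _.
have -> : (s * poly_height (\sum_(j < s) P`_j *: 'X^j)%R * poly_height Q
  = \sum_(j < s) (poly_height P * poly_height Q))%N.
  rewrite sum_nat_const card_ord mulnA; congr (_ * poly_height _ * _)%N.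
  rewrite -poly_def; apply/polyP => j; rewrite coef_poly; case: ltnP => // sj.
  by rewrite nth_default // (leq_trans sP).
apply: leq_sum => j _; rewrite -scalerAl coefZ coefXnM abszM.
case: ifP => _; first by rewrite muln0.
by rewrite leq_mul ?coef_le_height.
Qed.

Lemma horner_le_height P s m t : (size P <= s)%N -> (t <= m)%N ->
  (`|(P.[t%:Z])%R| <= s * m.+1 ^ s * poly_height P)%N.
Proof.
move=> sP tm; rewrite (horner_coef_wide _ sP).
apply: leq_trans (absz_sum_le _) _.
rewrite -mulnA -[X in (_ <= X * _)%N](card_ord s) -sum_nat_const.
apply: leq_sum => i _; rewrite abszM mulnC leq_mul ?coef_le_height //.
rewrite abszX absz_nat.
apply: (@leq_trans (m.+1 ^ i)%N); first by case: (val i) => // k; rewrite leq_exp2r // leqW.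
by rewrite leq_pexp2l // ltnW.
Qed.

(** Dividing [A - A.[t]] by ['X - t] costs at most a factor 2 in the values at the
    other integers, so the height is controlled one node at a time. *)
Lemma height_interpolation m s A (ts : seq nat) E :
  (size A <= s)%N -> uniq ts -> size ts = s -> all (fun t => t <= m)%N ts ->
  all (fun t => `|(A.[t%:Z])%R| <= E)%N ts ->
  (poly_height A <= (m.*2 + 5) ^ s * E)%N.
Proof.
elim: s A ts E => [|s IHs] A [|t ts] E //=.
  rewrite leqn0 size_poly_eq0 => /eqP -> _ _ _ _.
  by apply: height_leP => i; rewrite coef0.
move=> sA /andP[t_ts uts] [sts] /andP[tm tsm] /andP[At Ats].
have /factor_theorem[B AB] : root (A - (A.[t%:Z])%:P) t%:Z.
  by rewrite /root !hornerE subrr.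
have sB : (size B <= s)%N.
  have [->|B0] := eqVneq B 0; first by rewrite size_poly0.
  have := size_Mmonic B0 (monicXsubC t%:Z); rewrite -AB size_XsubC addn2 /= => e.
  rewrite -ltnS -e (leq_trans (size_polyD _ _)) // geq_max sA size_polyN.
  exact: leq_trans (size_polyC_leq1 _) _.
have Bts : all (fun t' => `|(B.[t'%:Z])%R| <= 2 * E)%N ts.
  apply/allP => u uts'; have := congr1 (fun P => P.[u%:Z]) AB.
  rewrite /= !hornerE => Eu.
  have tu : u%:Z != t%:Z by apply: contraNneq t_ts => -[<-].
  have := allP Ats _ uts'; move: At tu; move/(congr1 absz): Eu; rewrite abszM => Eu At tu Au.
  have : (`|(B.[u%:Z])%R| <= `|(B.[u%:Z])%R| * `|(u%:Z - t%:Z)%R|)%N.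
    by rewrite leq_pmulr // absz_gt0 subr_eq0.
  rewrite -Eu; lia.
have HB := IHs B ts _ sB uts sts tsm Bts.
have -> : A = (A.[t%:Z])%:P + B * ('X - t%:Z%:P) by rewrite -AB addrC subrK.
apply: height_leP => i; rewrite coefD coefC mulrBr coefB coefMX coefMC.
have HC : (1 <= (m.*2 + 5) ^ s)%N by rewrite expn_gt0 addn_gt0 orbT.
rewrite expnS; set C := ((_ + 5) ^ s)%N in HB HC *.
have Bi : (`|(if i == 0%N then 0 else B`_i.-1)%R| <= C * (2 * E))%N.
  by case: ifP => // _; apply: leq_trans HB; exact: coef_le_height.
have Bit : (`|(B`_i * t%:Z)%R| <= C * (2 * E) * m)%N.
  by rewrite abszM leq_mul //; apply: leq_trans HB; exact: coef_le_height.
have Ai : (`|(if i == 0%N then A.[t%:Z] else 0)%R| <= C * E)%N.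
  by case: ifP => _ //; apply: leq_trans At _; rewrite leq_pmull.
move: Bi Bit Ai.
set x := (if _ then A.[_] else _); set y := (if _ then _ else B`_ _); set z := B`_ _ * _.
nia.
Qed.

(** As many small values as the size of [A] would bound its height by interpolation. *)
Lemma count_small_values m A : A != 0 -> (size A <= m.+1)%N ->
  (count (fun t => (m.*2 + 5) ^ m.+1 * `|(A.[t%:Z])%R| < poly_height A)%N (iota 0 m.+1)
     < size A)%N.
Proof.
move=> A0 sA; rewrite ltnNge; apply/negP => le_count.
set C := (_ ^ m.+1)%N in le_count.
set small := (fun t => _) in le_count.
have C0 : (0 < C)%N by rewrite expn_gt0 addn_gt0 orbT.
pose ts := take (size A) (seq.filter small (iota 0 m.+1)).
have ts_small t : t \in ts -> small t /\ (t <= m)%N.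
  by move=> /mem_take; rewrite mem_filter mem_iota add0n ltnS => /andP[-> /andP[_ ->]].
have hA : (0 < poly_height A)%N by rewrite height_gt0.
have := @height_interpolation m (size A) A ts ((poly_height A).-1 %/ C).
rewrite leqnn take_uniq ?filter_uniq ?iota_uniq // size_takel ?size_filter //.
have small_le t : t \in ts -> (`|(A.[t%:Z])%R| <= (poly_height A).-1 %/ C)%N.
  by move=> /ts_small[+ _]; rewrite /small => lt_t; rewrite leq_divRL // mulnC -ltnS prednK.
have le_m t : t \in ts -> (t <= m)%N by case/ts_small.
move=> /(_ isT isT erefl (introT allP le_m) (introT allP small_le)).
apply/negP; rewrite -ltnNge.
apply: (@leq_ltn_trans (C * ((poly_height A).-1 %/ C)))%N.
  by rewrite leq_mul2r leq_pexp2l ?sA ?orbT // addnS.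
by rewrite mulnC (leq_ltn_trans (leq_trunc_div _ _)) // prednK.
Qed.

Definition gelfond_const m : nat :=
  ((m.*2 + 5) ^ m.+1) ^ 2 * (m.+1 * m.+1 ^ m.+1).

(** Gelfond's inequality. Neither factor is small at more than its degree of the
    [m + 1] integers [0, ..., m], so at one of them both are large. *)
Lemma height_factors m A B : A * B != 0 -> (size (A * B)%R <= m.+1)%N ->
  (poly_height A * poly_height B <= gelfond_const m * poly_height (A * B)%R)%N.
Proof.
rewrite mulf_eq0 negb_or => /andP[A0 B0] sAB.
have s1A : (0 < size A)%N by rewrite size_poly_gt0.
have s1B : (0 < size B)%N by rewrite size_poly_gt0.
have sAB' : ((size A + size B).-1 <= m.+1)%N by rewrite -size_mul.
have sA : (size A <= m.+1)%N by lia.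
have sB : (size B <= m.+1)%N by lia.
have cA := count_small_values A0 sA; have cB := count_small_values B0 sB.
set C := ((_ + 5) ^ m.+1)%N in cA cB.
set a := (fun t => _) in cA; set b := (fun t => _) in cB.
have : has (predC (predU a b)) (iota 0 m.+1).
  rewrite has_predC all_count neq_ltn size_iota; apply/orP; left.
have := count_predUI a b (iota 0 m.+1); lia.
case/hasP => t; rewrite mem_iota add0n ltnS => /andP[_ tm].
rewrite /= negb_or -!leqNgt => /andP[At Bt].
have := horner_le_height sAB tm; rewrite hornerM abszM => ABt.
apply: leq_trans (leq_mul At Bt) _.
by rewrite mulnACA mulnn /gelfond_const -/C -mulnA leq_mul2l ABt orbT.
Qed.

End Heights.

(** * The p-adic absolute value, integral approximation and Hensel's lemma *)

Section PadicIntegers.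
Variables (R : realType) (p : nat) (p_pr : prime p).
Local Notation Qp := (padic p_pr).
Local Notation "`[ x ]" := (padic_abs R x) (at level 0, format "`[ x ]").
Implicit Types (x y z : Qp) (F G : {poly int}).

Let p_gt0 : 0 < p%:R :> R. Proof. by rewrite ltr0n prime_gt0. Qed.

Lemma padic_abs0 : `[0 : Qp] = 0.
Proof. by apply/eqP; rewrite padic_abs_eq0. Qed.

Lemma padic_abs_gt0 x : (0 < `[x]) = (x != 0).
Proof. by rewrite lt0r padic_abs_eq0 padic_abs_ge0 andbT. Qed.

Lemma padic_abs_int_norm (a : int) : `[a%:~R : Qp] = ratr (padic_norm p a%:~R).
Proof. by rewrite -padic_abs_rat rmorph_int. Qed.

Lemma padic_abs1 : `[1 : Qp] = 1.
Proof. by rewrite -(rmorph1 (padic_rat p_pr)) padic_abs_rat padic_norm1 rmorph1. Qed.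

Lemma padic_absN x : `[- x] = `[x].
Proof.
rewrite -mulN1r padic_absM -(rmorphN1 (padic_rat p_pr)) padic_abs_rat.
by rewrite padic_normN // padic_norm1 rmorph1 mul1r.
Qed.

Lemma padic_absB x y : `[x - y] = `[y - x].
Proof. by rewrite -padic_absN opprB. Qed.

Lemma padic_absX x k : `[x ^+ k] = `[x] ^+ k.
Proof. by elim: k => [|k IH]; rewrite ?padic_abs1 // !exprS padic_absM IH. Qed.

Lemma padic_absV x : `[x^-1] = `[x]^-1.
Proof.
have [->|x0] := eqVneq x 0; first by rewrite invr0 padic_abs0 invr0.
have Vx0 : `[x] != 0 by rewrite padic_abs_eq0.
by apply: (mulfI Vx0); rewrite -padic_absM !divff ?padic_abs1.
Qed.

Lemma padic_absD_le x y (e : R) : `[x] <= e -> `[y] <= e -> `[x + y] <= e.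
Proof. by move=> xe ye; apply: le_trans (padic_abs_ultra _ _ _) _; rewrite ge_max xe. Qed.

Lemma padic_absB_le x y (e : R) : `[x] <= e -> `[y] <= e -> `[x - y] <= e.
Proof. by move=> xe ye; apply: padic_absD_le; rewrite ?padic_absN. Qed.

Lemma padic_absD_lt x y (e : R) : `[x] < e -> `[y] < e -> `[x + y] < e.
Proof. by move=> xe ye; apply: le_lt_trans (padic_abs_ultra _ _ _) _; rewrite gt_max xe. Qed.

Lemma padic_absD_eq x y : `[x] < `[y] -> `[x + y] = `[y].
Proof.
move=> xy; apply/le_anti; rewrite padic_absD_le ?(ltW xy) //=.
rewrite leNgt; apply/negP => h.
have := padic_absD_lt (h : `[x + y] < `[y]) (_ : `[- x] < `[y]).
by rewrite addrAC subrr add0r padic_absN ltxx => /(_ xy).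
Qed.

Lemma padic_absM_le1 x y : `[x] <= 1 -> `[y] <= 1 -> `[x * y] <= 1.
Proof. by move=> x1 y1; rewrite padic_absM mulr_ile1 ?padic_abs_ge0. Qed.

Lemma padic_abs_intE (a : int) : a != 0 ->
  `[a%:~R : Qp] = p%:R ^- logn p `|a|.
Proof.
move=> a0; rewrite padic_abs_int_norm.
have := padic_norm_frac p_pr a0 (oner_neq0 int); rewrite divr1 => ->.
by rewrite logn1 expr0 div1r fmorphV rmorphXn /= ratr_nat.
Qed.

Lemma padic_abs_int_le1 (a : int) : `[a%:~R : Qp] <= 1.
Proof.
have [->|a0] := eqVneq a 0; first by rewrite padic_abs0.
by rewrite padic_abs_intE // invf_le1 ?exprn_gt0 // exprn_ege1 // ler1n prime_gt0.
Qed.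

Lemma padic_abs_int_ge (a : int) : a != 0 -> `|a|%N%:R^-1 <= `[a%:~R : Qp].
Proof.
move=> a0; have a_gt0 : (0 < `|a|)%N by rewrite absz_gt0.
rewrite padic_abs_intE // lef_pV2 ?posrE ?exprn_gt0 // ?ltr0n //.
by rewrite -natrX ler_nat dvdn_leq // pfactor_dvdnn.
Qed.

Lemma padic_abs_coprime (a : int) : ~~ (p %| `|a|)%N -> `[a%:~R : Qp] = 1.
Proof.
move=> pa; have a0 : a != 0 by apply: contraNneq pa => ->; rewrite dvdn0.
have : (logn p `|a| == 0)%N.
  by rewrite eqn0Ngt logn_gt0 mem_primes p_pr absz_gt0 a0.
by rewrite padic_abs_intE // => /eqP ->; rewrite invr1.
Qed.

Lemma padic_abs_p : `[p%:~R : Qp] = p%:R^-1.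
Proof.
by rewrite padic_abs_intE ?eqz_nat -?lt0n ?prime_gt0 //= logn_prime // eqxx expr1.
Qed.

(** The rationals are dense, and a rational [a / b] with [b] prime to [p] is congruent to
    [a * u] modulo [p ^ k] when [u] inverts [b] modulo [p ^ k]. *)
Lemma padic_int_approx x k : `[x] <= 1 -> exists a : int, `[x - a%:~R] <= p%:R ^- k.
Proof.
move=> x1; have e0 : 0 < p%:R ^- k :> R by rewrite invr_gt0 exprn_gt0.
have e1 : p%:R ^- k <= 1 :> R.
  by rewrite invf_le1 ?exprn_gt0 // exprn_ege1 // ler1n prime_gt0.
have [q xq] := padic_abs_dense x e0.
have q1 : `[padic_rat p_pr q] <= 1.
  rewrite -[padic_rat p_pr q](subKr x) padic_absB_le //.
  exact: le_trans (ltW xq) e1.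
have qE : padic_rat p_pr q = (numq q)%:~R / (denq q)%:~R.
  by rewrite -[in LHS](divq_num_den q) fmorph_div !rmorph_int.
have d_neq0 : `[(denq q)%:~R : Qp] != 0.
  by rewrite padic_abs_intE ?denq_neq0 // invr_neq0 // expf_neq0 // gt_eqF.
(* As [q] is [p]-adically integral, its denominator is prime to [p]. *)
have pd : ~~ (p %| `|denq q|)%N.
  apply/negP => pd; have pn : ~~ (p %| `|numq q|)%N.
    apply/negP => pn; have := coprime_num_den q; rewrite /coprime => /eqP g1.
    have : (p %| gcdn `|numq q| `|denq q|)%N by rewrite dvdn_gcd pn.
    by rewrite g1 dvdn1 => /eqP p1; move: p_pr; rewrite p1.
  have dlt : `[(denq q)%:~R : Qp] < 1.
    case/dvdnP: pd => c dE; have -> : denq q = (c%:Z * p%:Z).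
      by have := denq_gt0 q; lia.
    rewrite rmorphM padic_absM padic_abs_p.
    apply: (@le_lt_trans _ _ (p%:R^-1)); last by rewrite invf_lt1 // ltr1n prime_gt1.
    by rewrite ler_piMl ?invr_ge0 ?padic_abs_int_le1 // ltW.
  move: q1; rewrite qE padic_absM padic_absV padic_abs_coprime // mul1r leNgt.
  by rewrite invf_gt1 ?dlt // lt0r d_neq0 padic_abs_ge0.
have [[u v] /= uv] : exists uv : int * int, uv.1 * denq q + uv.2 * (p ^ k)%N%:Z = 1.
  have cop : coprimez (denq q) (p ^ k)%N%:Z.
    by rewrite coprimezE /= coprimeXr // coprime_sym prime_coprime.
  have [u [v uv]] := Bezoutz (denq q) (p ^ k)%N%:Z.
  by exists (u, v); rewrite /= uv; apply/eqP.
exists (numq q * u); rewrite -[x](subrK (padic_rat p_pr q)) -addrA.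
apply: padic_absD_le; first exact: ltW.
have dQ : (denq q)%:~R != 0 :> Qp by rewrite -(padic_abs_eq0 R).
have -> : padic_rat p_pr q - (numq q * u)%:~R
    = (numq q * v)%:~R * p%:~R ^+ k / (denq q)%:~R.
  have uvQ : u%:~R * (denq q)%:~R + v%:~R * p%:~R ^+ k = 1 :> Qp.
    have := congr1 (fun a : int => a%:~R : Qp) uv.
    by rewrite /= rmorphD !rmorphM /= -!pmulrn natrX.
  apply: (mulIf dQ); rewrite qE mulrBl divfK // divfK // !rmorphM /=.
  rewrite -(mulrA _ v%:~R) (_ : v%:~R * _ = 1 - u%:~R * (denq q)%:~R); first by ring.
  by apply/esym/eqP; rewrite subr_eq addrC uvQ.
rewrite !padic_absM padic_absX padic_abs_p padic_absV (padic_abs_coprime pd) invr1 mulr1.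
by rewrite exprVn ler_piMl ?padic_abs_int_le1 // ltW.
Qed.

End PadicIntegers.

Section Eval.
Variables (R : realType) (p : nat) (p_pr : prime p).
Local Notation Qp := (padic p_pr).
Local Notation "`[ x ]" := (padic_abs R x) (at level 0, format "`[ x ]").
Implicit Types (x y z : Qp) (F G : {poly int}).

Definition zeval F x : Qp := (map_poly intr F).[x].

Lemma zevalD F G x : zeval (F + G) x = zeval F x + zeval G x.
Proof. by rewrite /zeval rmorphD hornerD. Qed.
Lemma zevalN F x : zeval (- F) x = - zeval F x.
Proof. by rewrite /zeval rmorphN hornerN. Qed.
Lemma zevalM F G x : zeval (F * G) x = zeval F x * zeval G x.
Proof. by rewrite /zeval rmorphM hornerM. Qed.
Lemma zevalC (a : int) x : zeval a%:P x = a%:~R.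
Proof. by rewrite /zeval map_polyC hornerC. Qed.
Lemma zevalX x : zeval 'X x = x.
Proof. by rewrite /zeval map_polyX hornerX. Qed.
Lemma zevalXn k x : zeval 'X^k x = x ^+ k.
Proof. by rewrite /zeval map_polyXn hornerXn. Qed.
Lemma zevalZ (a : int) F x : zeval (a *: F) x = a%:~R * zeval F x.
Proof. by rewrite -mul_polyC zevalM zevalC. Qed.
Definition zevalE := (zevalD, zevalN, zevalM, zevalC, zevalX, zevalXn, zevalZ).

Lemma zeval_le1 F x : `[x] <= 1 -> `[zeval F x] <= 1.
Proof.
move=> x1; elim/poly_ind: F => [|F c IH]; first by rewrite zevalC padic_abs_int_le1.
rewrite !zevalE; apply: padic_absD_le; last exact: padic_abs_int_le1.
exact: padic_absM_le1.
Qed.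

Lemma zeval_lipschitz F x h : `[x] <= 1 -> `[h] <= 1 ->
  `[zeval F (x + h) - zeval F x] <= `[h].
Proof.
move=> x1 h1; elim/poly_ind: F => [|F c IH].
  by rewrite !zevalC subrr padic_abs0 padic_abs_ge0.
rewrite !zevalE [X in `[X]](_ : _ = (zeval F (x + h) - zeval F x) * (x + h) + zeval F x * h).
  apply: padic_absD_le; rewrite padic_absM.
    apply: le_trans IH; rewrite ler_piMr ?padic_abs_ge0 // padic_absD_le //.
  by rewrite ler_piMl ?padic_abs_ge0 // zeval_le1.
ring.
Qed.

Lemma zeval_taylor2 F x h : `[x] <= 1 -> `[h] <= 1 ->
  `[zeval F (x + h) - (zeval F x + zeval F^`() x * h)] <= `[h] ^+ 2.
Proof.
move=> x1 h1; elim/poly_ind: F => [|F c IH].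
  by rewrite derivC !zevalC mul0r addr0 subrr padic_abs0 exprn_ge0 ?padic_abs_ge0.
rewrite derivD derivC addr0 derivM derivX mulr1 !zevalE.
rewrite [X in `[X]](_ : _ =
  (zeval F (x + h) - (zeval F x + zeval F^`() x * h)) * (x + h) + zeval F^`() x * h ^+ 2).
  apply: padic_absD_le; rewrite padic_absM.
    by apply: le_trans IH; rewrite ler_piMr ?padic_abs_ge0 // padic_absD_le.
  by rewrite -padic_absX ler_piMl ?padic_abs_ge0 // zeval_le1.
ring.
Qed.

(** Newton's iteration with the derivative frozen at [x]: each step multiplies the
    absolute value of [F] by at most its initial value, so completeness gives a root. *)
Lemma hensel F x : `[x] <= 1 -> `[zeval F^`() x] = 1 -> `[zeval F x] < 1 ->
  exists2 a, zeval F a = 0 & `[x - a] <= `[zeval F x].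
Proof.
move=> x1 d1 e1; set d := zeval _ x in d1; set e := `[_] in e1 *.
have e_ge0 : 0 <= e by apply: padic_abs_ge0.
have [e0|e_neq0] := eqVneq e 0.
  exists x; first by apply/eqP; rewrite -(padic_abs_eq0 R); apply/eqP.
  by rewrite subrr padic_abs0.
have d_neq0 : d != 0 by rewrite -(padic_abs_eq0 R) d1 oner_eq0.
pose u k := iter k (fun y => y - zeval F y / d) x.
have eX k : e ^+ k.+1 <= e by rewrite exprS ler_piMr // exprn_ile1 // ltW.
have uP k : `[u k - x] <= e /\ `[zeval F (u k)] <= e ^+ k.+1.
  elim: k => [|k [ux Fu]]; first by rewrite /= subrr padic_abs0 expr1.
  have u1 : `[u k] <= 1.
    by rewrite -(subrK x (u k)) padic_absD_le // (le_trans ux) // ltW.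
  set h := - (zeval F (u k) / d); have -> : u k.+1 = u k + h by [].
  have hE : `[h] <= e ^+ k.+1 by rewrite padic_absN padic_absM padic_absV d1 invr1 mulr1.
  have h1 : `[h] <= 1 by rewrite (le_trans hE) // (le_trans (eX _)) // ltW.
  split; first by rewrite addrAC padic_absD_le // (le_trans hE).
  rewrite -(subrK (zeval F (u k) + zeval F^`() (u k) * h) (zeval F (u k + h))).
  apply: padic_absD_le.
    apply: le_trans (zeval_taylor2 _ u1 h1) _.
    apply: (@le_trans _ _ (e ^+ k.+1 * e)); last by rewrite -exprSr.
    rewrite expr2 ler_pM ?padic_abs_ge0 //; exact: le_trans hE (eX _).
  rewrite (_ : _ + _ = (zeval F^`() (u k) - d) * h); last first.
    rewrite mulrBl addrC; congr (_ + _); rewrite /h mulrN opprK mulrCA divff //.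
    by rewrite mulr1.
  rewrite padic_absM exprS ler_pM ?padic_abs_ge0 //.
  have := zeval_lipschitz F^`() x1 (le_trans ux (ltW e1)).
  by rewrite [x + _]addrC subrK => /le_trans; apply.
have uD k j : (k <= j)%N -> `[u j - u k] <= e ^+ k.+1.
  move=> /subnK <-; elim: (j - k)%N => [|i IH].
    by rewrite subrr padic_abs0 exprn_ge0.
  rewrite addSn /= -/(u (i + k)%N) addrAC padic_absB_le // padic_absM padic_absV d1.
  rewrite invr1 mulr1; apply: le_trans (uP _).2 _.
  by rewrite ler_wiXn2l ?(ltW e1) // ltnS leq_addl.
have e_small (t : R) : 0 < t -> exists K, forall k, (K <= k)%N -> e ^+ k < t.
  move=> t0; have /cvgrPdist_lt/(_ t t0)[K _ hK] : (fun k => e ^+ k) @ \oo --> (0 : R).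
    by apply: cvg_expr; rewrite ger0_norm.
  exists K => k /hK /=; rewrite sub0r normrN ger0_norm ?exprn_ge0 //.
have [t t0|a ua] := @padic_complete R p p_pr u.
  have [K hK] := e_small _ t0; exists K => m n Km Kn.
  rewrite -(subrK (u K) (u m)) -addrA padic_absD_lt //.
    by apply: le_lt_trans (uD _ _ Km) (hK _ _).
  by rewrite padic_absB; apply: le_lt_trans (uD _ _ Kn) (hK _ _).
have near_a (t : R) : 0 < t -> exists k, `[a - u k] < t /\ `[zeval F (u k)] < t.
  move=> t0; move/cvgrPdist_lt/(_ t t0) : ua => [K _ hK].
  have [L hL] := e_small _ t0; exists (maxn K L); split.
    have /= := hK _ (leq_maxl K L).
    by rewrite sub0r normrN ger0_norm ?padic_abs_ge0 // padic_absB.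
  by apply: le_lt_trans (uP _).2 (hL _ _); rewrite leqW // leq_maxr.
have u1 k : `[u k] <= 1.
  by rewrite -(subrK x (u k)) padic_absD_le // (le_trans (uP k).1) // ltW.
exists a.
  apply/eqP; rewrite -(padic_abs_eq0 R); apply/negPn/negP => Fa.
  have Fa0 : 0 < `[zeval F a] by rewrite lt0r Fa padic_abs_ge0.
  have [k [ak Fk]] := near_a _ Fa0.
  have Fa1 : 0 < Num.min 1 `[zeval F a] by rewrite lt_min ltr01.
  have {k ak Fk} [k [+ +]] := near_a _ Fa1; rewrite !lt_min => /andP[ak1 ak] /andP[_ Fk].
  have := zeval_lipschitz F (u1 k) (ltW ak1); rewrite [u k + _]addrC subrK => Fak.
  have := padic_absD_lt (le_lt_trans Fak ak) Fk; rewrite subrK ltxx //.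
have e_gt0 : 0 < e by rewrite lt0r e_neq0.
have [k [ak _]] := near_a _ e_gt0.
rewrite -(subrK (u k) x) -addrA padic_absD_le //; first by rewrite padic_absB (uP k).1.
by rewrite padic_absB ltW.
Qed.

End Eval.

(** * Coprime polynomials with small value at a transcendental number *)

Section GoodPolynomials.
Variables (R : realType) (p : nat) (p_pr : prime p) (xi : padic p_pr).
Local Notation Qp := (padic p_pr).
Local Notation "`[ x ]" := (padic_abs R x) (at level 0, format "`[ x ]").
Hypothesis xi_int : `[xi] <= 1.
Hypothesis xi_transc : forall F : {poly int}, F != 0 -> zeval F xi != 0.
Variable m : nat.
Local Notation w := m.+1.
Implicit Types (P Q A B F : {poly int}).

Let p_gt0 : 0 < p%:R :> R. Proof. by rewrite ltr0n prime_gt0. Qed.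

Lemma zeval_int F (a : int) : zeval F (a%:~R : Qp) = (F.[a])%:~R.
Proof. by rewrite /zeval horner_map. Qed.

Lemma padic_abs_dvd (a : int) k : ((p ^ k)%N%:Z %| a)%Z -> `[a%:~R : Qp] <= p%:R ^- k.
Proof.
case/dvdzP => b ->; rewrite rmorphM padic_absM /= -pmulrn natrX padic_absX.
have -> : `[p%:R : Qp] = p%:R^-1 by rewrite -(padic_abs_p R p_pr).
by rewrite exprVn ler_piMl ?padic_abs_int_le1 // invr_ge0 exprn_ge0 // ltW.
Qed.

(** Pigeonhole on the residues modulo [p ^ k] of the values of the polynomials with
    coefficients in [0, ..., X], where [p ^ k] is just below [X ^ w]. *)
Lemma dirichlet X : (0 < X)%N -> exists P,
  [/\ P != 0, (size P <= w)%N, (poly_height P <= X)%N &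
      `[zeval P xi] * X%:R ^+ w <= p%:R].
Proof.
move=> X0; pose k := trunc_log p (X ^ w).
have p1 := prime_gt1 p_pr.
have [leX ltX] : (p ^ k <= X ^ w)%N /\ (X ^ w < p ^ k.+1)%N.
  by apply/andP/trunc_log_bounds; rewrite // expn_gt0 X0.
have [a xia] := padic_int_approx k xi_int.
pose pol (f : {ffun 'I_w -> 'I_X.+1}) : {poly int} := rVpoly (\row_i (f i : nat)%:Z).
pose d := (p ^ k)%N.
have d0 : (0 < d)%N by rewrite expn_gt0 prime_gt0.
have res_lt (z : int) : (`|(z %% d%:Z)%Z| < d)%N.
  by have := ltz_pmod z (d0 : 0 < d%:Z); have := modz_ge0 z (lt0r_neq0 (d0 : 0 < d%:Z)); lia.
pose res f : 'I_d := Ordinal (res_lt (pol f).[a]).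
have /injectivePn[f [g fg resfg]] : ~~ injectiveb res.
  apply/negP => /injectiveP/leq_card; rewrite card_ffun !card_ord leqNgt => /negP[].
  by apply: leq_ltn_trans leX _; rewrite ltn_exp2r.
exists (pol f - pol g); have coefE i : exists u v : 'I_X.+1, (pol f - pol g)`_i = u%:Z - v%:Z.
  rewrite coefB !coef_rVpoly; case: insubP => [j _ _|_]; first by exists (f j), (g j); rewrite !mxE.
  by exists ord0, ord0.
split.
- rewrite subr_eq0; apply: contra_neq fg => fg; apply/ffunP => i; apply/val_inj.
  have := congr1 (fun P : {poly int} => P`_i) fg.
  by rewrite /= !coef_rVpoly_ord !mxE => -[].
- by rewrite (leq_trans (size_polyD _ _)) // size_polyN geq_max !size_poly.
- apply: height_leP => i; have [u [v ->]] := coefE i.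
  by have := ltn_ord u; have := ltn_ord v; lia.
- set P := _ - _; have Pd : (d%:Z %| P.[a])%Z.
    rewrite /P hornerD hornerN -eqz_mod_dvd; apply/eqP.
    have := congr1 val resfg => /=.
    have d0' : d%:Z != 0 by rewrite lt0r_neq0.
    have := modz_ge0 (pol f).[a] d0'; have := modz_ge0 (pol g).[a] d0'; lia.
  have Pxi : `[zeval P xi] <= p%:R ^- k.
    have := zeval_lipschitz (R := R) P (padic_abs_int_le1 R p_pr a)
       (_ : `[xi - a%:~R] <= 1).
    rewrite [_ + (_ - _)]addrC subrK => Plip.
    rewrite -(subrK (zeval P a%:~R) (zeval P xi)) padic_absD_le //.
      apply: le_trans (Plip _) (xia); apply: le_trans (xia) _.
      by rewrite invf_le1 ?exprn_gt0 // exprn_ege1 // ler1n prime_gt0.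
    by rewrite zeval_int padic_abs_dvd.
  apply: le_trans (ler_wpM2r _ Pxi) _; first by rewrite exprn_ge0.
  rewrite mulrC ler_pdivrMr ?exprn_gt0 // -exprS -!natrX ler_nat; exact: ltnW.
Qed.

(** Finitely many polynomials have bounded size and height, and none vanishes at the
    transcendental number [xi]. *)
Lemma zeval_bounded_below s N : exists2 delta : R, 0 < delta &
  forall P, P != 0 -> (size P <= s)%N -> (poly_height P <= N)%N -> delta <= `[zeval P xi].
Proof.
pose pol (f : {ffun 'I_s -> 'I_(N.*2.+1)}) : {poly int} :=
  rVpoly (\row_i ((f i : nat)%:Z - N%:Z)).
exists (\big[Num.min/1]_(f | pol f != 0) `[zeval (pol f) xi]).
  by apply: lt_bigmin => // f f0; rewrite padic_abs_gt0 xi_transc.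
move=> P P0 sP hP.
pose f : {ffun 'I_s -> 'I_(N.*2.+1)} :=
  [ffun i : 'I_s => inord `|(P`_i + N%:Z)%R|%N].
have fP : pol f = P.
  rewrite -[RHS](poly_rV_K sP); congr rVpoly; apply/rowP => i; rewrite !mxE ffunE.
  have := coef_le_height P i => hi; rewrite inordK; lia.
by rewrite -fP; apply: bigmin_le_cond; rewrite fP.
Qed.

(** The exponent [w] is the one that Dirichlet's principle provides in degree [m]; it
    is kept for all sizes [s], so that the size can be minimized. *)
Definition good K N s Q :=
  [/\ zcontents Q = 1, (size Q <= s)%N, (N <= poly_height Q)%N &
      `[zeval Q xi] * (poly_height Q)%:R ^+ w <= K].

Lemma zcontents1_neq0 Q : zcontents Q = 1 -> Q != 0.
Proof. by move=> cQ; rewrite -zcontents_eq0 cQ. Qed.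

(** Dividing by the content [c] costs a factor at most [c] in the value at [xi], which
    the height, smaller by a factor [c], compensates. The heights obtained are
    unbounded because polynomials of bounded height have values bounded below. *)
Lemma good_dirichlet : (0 < m)%N -> forall N, exists Q, good p%:R N w Q.
Proof.
move=> m0 N; have [delta delta0 deltaP] := zeval_bounded_below w N.
pose X := (Num.truncn (p%:R / delta)).+1.
have [P [P0 sP hP PX]] := @dirichlet X isT.
have X_ge1 : 1 <= X%:R :> R by rewrite ler1n.
pose c := zcontents P; have c0 : c != 0 by rewrite zcontents_eq0.
have cE : P = c *: zprimitive P by apply: zpolyEprim.
have hPE : poly_height P = (`|c| * poly_height (zprimitive P))%N by rewrite {1}cE heightZ.
have Q0 : zprimitive P != 0 by rewrite zprimitive_eq0.
have hQ0 : (0 < poly_height (zprimitive P))%N by rewrite height_gt0.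
have c_gt0 : 0 < `|c|%N%:R :> R by rewrite ltr0n absz_gt0.
have cX : `|c|%N%:R <= X%:R :> R by rewrite ler_nat (leq_trans _ hP) // hPE leq_pmulr.
have hQX : (poly_height (zprimitive P))%:R * `|c|%N%:R <= X%:R :> R.
  by rewrite -natrM ler_nat mulnC -hPE.
(* The [p]-adic absolute value of [c] is at least the inverse of the usual one. *)
have VQ : `[zeval (zprimitive P) xi] <= `|c|%N%:R * `[zeval P xi].
  rewrite {2}cE zevalZ padic_absM mulrA ler_peMl ?padic_abs_ge0 //.
  by rewrite mulrC -ler_pdivrMr // div1r padic_abs_int_ge.
have p_ge0 : 0 <= p%:R :> R by [].
exists (zprimitive P); split.
- by rewrite zcontents_primitive P0.
- by rewrite size_zprimitive.
- rewrite leqNgt; apply/negP => /ltnW hN.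
  have := deltaP _ Q0 _ hN; rewrite size_zprimitive => /(_ sP) dQ.
  have : delta * X%:R <= p%:R.
    apply: le_trans PX; rewrite exprS mulrA ler_pM ?(ltW delta0) //.
      apply: le_trans dQ _; apply: le_trans VQ _; rewrite mulrC.
      by rewrite ler_wpM2l ?padic_abs_ge0.
    by rewrite -[X in X <= _]expr1 ler_weXn2l.
  rewrite leNgt => /negP[]; rewrite mulrC -ltr_pdivrMr //.
  by rewrite /X truncnS_gt // num_real.
- apply: le_trans PX; apply: le_trans (ler_wpM2r _ VQ) _; first exact: exprn_ge0.
  rewrite [_ * `[_]]mulrC -mulrA ler_wpM2l ?padic_abs_ge0 //.
  apply: le_trans (_ : (`|c|%N%:R * (poly_height (zprimitive P))%:R) ^+ w <= _); last first.
    by rewrite lerXn2r ?nnegrE // mulrC.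
  rewrite exprMn ler_wpM2r ?exprn_ge0 //.
  by rewrite -[X in X <= _]expr1 ler_weXn2l // ler1n absz_gt0.
Qed.

(** If one factor stays among finitely many polynomials, its value at [xi] is bounded
    below, so the other factor inherits the whole smallness of the product. *)
Lemma good_factor_bounded K K1 s :
  (forall K, exists N, forall Q, ~ good K N s Q) ->
  exists N, forall A B, zcontents A = 1 -> zcontents B = 1 ->
    (size A <= s)%N -> (size B <= s)%N -> (size (A * B)%R <= w)%N ->
    `[zeval (A * B) xi] * (poly_height (A * B)%R)%:R ^+ w <= K ->
    `[zeval A xi] * (poly_height A)%:R ^+ w <= K1 ->
    (poly_height (A * B)%R < N)%N.
Proof.
move=> bad; have [N1 bad1] := bad K1.
have [delta delta0 deltaP] := zeval_bounded_below s N1.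
pose C := gelfond_const m.
have [N2 bad2] := bad (K * C%:R ^+ w / delta).
exists (s * N1 * N2).+1 => A B cA cB sA sB sAB gAB gA.
have A0 := zcontents1_neq0 cA; have B0 := zcontents1_neq0 cB.
have hA : (poly_height A <= N1)%N.
  by rewrite leqNgt; apply/negP => /ltnW hA; apply: (bad1 A).
have hA0 : (0 < poly_height A)%N by rewrite height_gt0.
have dA := deltaP _ A0 sA hA.
have hB : (poly_height B <= N2)%N.
  rewrite leqNgt; apply/negP => /ltnW hB; apply: (bad2 B); split=> //.
  have hBC : (poly_height B <= C * poly_height (A * B)%R)%N.
    apply: leq_trans (height_factors _ sAB); first by rewrite leq_pmull.
    by rewrite mulf_neq0.
  rewrite ler_pdivlMr //.
  apply: (@le_trans _ _ (`[zeval (A * B) xi] * (C * poly_height (A * B)%R)%:R ^+ w)).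
    rewrite mulrAC zevalM padic_absM ler_pM ?mulr_ge0 ?padic_abs_ge0 ?exprn_ge0 ?(ltW delta0) //.
      by rewrite mulrC ler_wpM2r ?padic_abs_ge0.
    by rewrite lerXn2r ?nnegrE // ler_nat.
  by rewrite natrM exprMn mulrCA mulrC ler_wpM2r ?exprn_ge0.
rewrite ltnS (leq_trans (heightM B sA)) //.
by rewrite leq_mul // leq_mul.
Qed.

(** Good approximations of minimal size and large height have no proper factorization: by
    multiplicativity of heights and of values one of the two factors would be a good
    approximation of smaller size, hence one of finitely many, and then so would be
    the other. *)
Lemma good_irreducible : (0 < m)%N -> exists K, forall N, exists2 Q, good K N w Q &
  forall A B, Q = A * B -> size A = 1%N \/ size B = 1%N.
Proof.
move=> m0.
have /ex_minnP[s /asboolP[K goodK] s_min] :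
    exists s, `[< exists K, forall N, exists Q, good K N s Q >].
  by exists w; apply/asboolP; exists p%:R; exact: good_dirichlet.
have sw : (s <= w)%N by apply: s_min; apply/asboolP; exists p%:R; exact: good_dirichlet.
case: s => [|s] in goodK s_min sw.
  have [Q [cQ]] := goodK 0%N; rewrite leqn0 size_poly_eq0 => /eqP Q0.
  by move: (zcontents1_neq0 cQ); rewrite Q0 eqxx.
have bad K' : exists N, forall Q, ~ good K' N s Q.
  apply: contrapT => H; have: (s.+1 <= s)%N; last by rewrite ltnn.
  apply: s_min; apply/asboolP; exists K' => N; apply: contrapT => H'.
  by apply: H; exists N => Q gQ; apply: H'; exists Q.
pose C := gelfond_const m.
(* If both factors exceeded [K1] >= 1, their product would exceed [K1 ^ 2] >= [K1]. *)
pose K1 := Num.max 1 (K * C%:R ^+ w).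
have [N1 bad1] := good_factor_bounded K K1 bad.
exists K => N; have [Q gQ] := goodK (maxn N N1).
have [cQ sQ hQ VQ] := gQ.
move: hQ; rewrite geq_max => /andP[hQN hQN1].
exists Q; first by split=> //; exact: leq_trans sw.
move=> A B QAB; apply: contrapT => /not_orP[sA1 sB1].
have Q0 := zcontents1_neq0 cQ.
have: Q = zprimitive A * zprimitive B.
  by rewrite -zprimitiveM -QAB {1}[Q]zpolyEprim cQ scale1r.
have AB0 : A * B != 0 by rewrite -QAB.
have /andP[A0 B0] : (A != 0) && (B != 0) by rewrite -negb_or -mulf_eq0.
have sAB : ((size A + size B).-1 <= s.+1)%N by rewrite -size_mul // -QAB.
have sA0 : (0 < size A)%N by rewrite size_poly_gt0.
have sB0 : (0 < size B)%N by rewrite size_poly_gt0.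
have cA' : zcontents (zprimitive A) = 1 by rewrite zcontents_primitive A0.
have cB' : zcontents (zprimitive B) = 1 by rewrite zcontents_primitive B0.
have sA' : (size (zprimitive A) <= s)%N by rewrite size_zprimitive; lia.
have sB' : (size (zprimitive B) <= s)%N by rewrite size_zprimitive; lia.
move: (zprimitive A) (zprimitive B) cA' cB' sA' sB' => {sAB sA0 sB0 A0 B0 AB0 sA1 sB1 QAB} {}A {}B.
move=> cA cB sA sB QAB; subst Q.
have VAB_lt : `[zeval A xi] * (poly_height A)%:R ^+ w <= K1 \/
    `[zeval B xi] * (poly_height B)%:R ^+ w <= K1.
  apply: contrapT => /not_orP[/negP + /negP]; rewrite -!ltNge => VA VB.
  have K1_ge1 : 1 <= K1 by rewrite le_max lexx.
  have : K1 * K1 < K * C%:R ^+ w.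
    apply: lt_le_trans (ltr_pM _ _ VA VB) _; rewrite ?(le_trans ler01) //.
    rewrite mulrACA -padic_absM -zevalM -exprMn -natrM.
    apply: (@le_trans _ _ (`[zeval (A * B) xi] * (C * poly_height (A * B)%R)%:R ^+ w)).
      rewrite ler_wpM2l ?padic_abs_ge0 // lerXn2r ?nnegrE // ler_nat.
      by apply: height_factors; rewrite // (leq_trans sQ).
    by rewrite natrM exprMn mulrCA mulrC ler_wpM2r ?exprn_ge0.
  have : K * C%:R ^+ w <= K1 by rewrite le_max lexx orbT.
  nra.
have sAB : (size (A * B)%R <= w)%N by exact: leq_trans sw.
case: VAB_lt => [VA|VB].
  by have := bad1 A B cA cB sA sB sAB VQ VA; rewrite ltnNge hQN1.
by have := bad1 B A cB cA sB sA; rewrite mulrC ltnNge hQN1 => /(_ sAB VQ VB).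
Qed.

(** Dirichlet's principle at a scale slightly below the height of an irreducible good
    approximation [Q] yields a [P] too small to be a multiple of [Q]. *)
Lemma coprime_good_pair : (0 < m)%N -> exists K : R, forall N, exists X P Q,
  [/\ (N <= X)%N, coprimep P Q /\ (P != 0 /\ Q != 0),
      (size P <= w)%N /\ (size Q <= w)%N,
      (poly_height P <= X)%N /\ (poly_height Q <= X)%N &
      `[zeval P xi] * X%:R ^+ w <= K /\ `[zeval Q xi] * X%:R ^+ w <= K].
Proof.
move=> m0; have [K irrK] := good_irreducible m0.
pose C := gelfond_const m.
have C0 : (0 < C)%N by rewrite /C /gelfond_const !(muln_gt0, expn_gt0) addnS.
exists (Num.max K (p%:R * (2 * C)%:R ^+ w)) => N.
have [Q [cQ sQ hQ VQ] irrQ] := irrK (maxn N C.+1).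
have Q0 := zcontents1_neq0 cQ.
move: hQ; rewrite geq_max => /andP[hN hC].
pose X := poly_height Q; pose Y := (X.-1 %/ C)%N.
have Y0 : (0 < Y)%N by rewrite divn_gt0 // -ltnS prednK // (leq_trans _ hC).
have CY : (C * Y < X)%N.
  by rewrite mulnC (leq_ltn_trans (leq_trunc_div _ _)) // prednK // (leq_trans _ hC).
have XY : (X <= 2 * C * Y)%N.
  have := ltn_ceil X.-1 C0; rewrite -/Y; rewrite -ltnS prednK ?(leq_trans _ hC) //; nia.
have [P [P0 sP hP VP]] := dirichlet Y0.
exists X, P, Q; split=> //.
- split=> //; apply/negPn/negP => ncop.
  set g := gcdp P Q in ncop.
  have [r Qr] := dvdpP_int (dvdp_gcdr P Q); have [t Pt] := dvdpP_int (dvdp_gcdl P Q).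
  case: (irrQ _ _ Qr) => [sg|sr].
    by move: ncop; rewrite /coprimep -size_zprimitive sg eqxx.
  have g0 : zprimitive g != 0.
    by apply: contraNneq Q0 => g0; rewrite Qr g0 mul0r.
  have Qg : Q = zprimitive g.
    have [c c0 rE] := size_poly1P _ (introT eqP sr).
    move: cQ; rewrite Qr rE mulrC mul_polyC zcontentsZ zcontents_primitive.
    by rewrite -(zprimitive_eq0) g0 mulr1 => ->; rewrite scale1r.
  have t0 : (0 < poly_height t)%N.
    by rewrite height_gt0; apply: contraNneq P0 => t0; rewrite Pt t0 mulr0.
  have := @height_factors m Q t; rewrite Qg -Pt => /(_ P0 sP); apply/negP.
  rewrite -ltnNge -Qg -/X; apply: leq_ltn_trans (leq_mul (leqnn C) hP) _.
  by apply: leq_trans CY _; rewrite leq_pmulr.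
- split=> //; apply: leq_trans hP _; apply: leq_trans (ltnW CY).
  by rewrite leq_pmull.
- split; rewrite le_max; last by rewrite VQ.
  apply/orP; right; apply: (@le_trans _ _ (`[zeval P xi] * (2 * C * Y)%:R ^+ w)).
    by rewrite ler_wpM2l ?padic_abs_ge0 // lerXn2r ?nnegrE // ler_nat.
  by rewrite natrM exprMn mulrCA mulrC ler_wpM2r ?exprn_ge0.
Qed.

End GoodPolynomials.

(** * Reduction modulo the lattice spanned by two coprime polynomials *)

Section Rounding.
Implicit Types (P Q A B F : {poly int}).

Lemma coefM_norm_le s (b X : nat) (alpha : {poly rat}) P i : (size alpha <= s)%N ->
  (forall j, `|alpha`_j| <= b%:R) -> (poly_height P <= X)%N ->
  `|(alpha * map_poly intr P)`_i| <= (s * (b * X))%N%:R.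
Proof.
move=> s_alpha b_alpha hP.
have -> : alpha = \sum_(j < s) alpha`_j *: 'X^j.
  rewrite -poly_def; apply/polyP => j; rewrite coef_poly; case: ltnP => // sj.
  by rewrite nth_default // (leq_trans s_alpha).
rewrite mulr_suml coef_sum (le_trans (ler_norm_sum _ _ _)) //.
rewrite natrM -[s in s%:R]card_ord mulr_natl -sumr_const.
apply: ler_sum => j _; rewrite -scalerAl coefZ coefXnM normrM natrM.
rewrite ler_pM //; case: ifP => _; first by rewrite normr0.
rewrite coef_map /= -intr_norm -[X%:R]/(X%:Z%:~R) ler_int.
by rewrite -abszE lez_nat (leq_trans (coef_le_height _ _)).
Qed.

(** The multiples of [P] of degree at most [n] together with those of [Q] span all
    polynomials of degree at most [n]; rounding the coordinates of [F] in this
    generating family leaves a remainder which is a combination with coefficients in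
    [0, M[ of polynomials of height at most [X]. *)
Lemma small_representative m n M X P Q F :
  (0 < M)%N -> (m.*2 <= n.+1)%N -> coprimep P Q -> P != 0 -> Q != 0 ->
  (size P <= m.+1)%N -> (size Q <= m.+1)%N ->
  (poly_height P <= X)%N -> (poly_height Q <= X)%N -> (size F <= n.+1)%N ->
  exists A B, let r := F - M%:Z *: (A * P + B * Q) in
    (size r <= n.+1)%N /\ (poly_height r <= 2 * (n.+1 * (M * X)))%N.
Proof.
move=> M0 mn copPQ P0 Q0 sP sQ hP hQ sF.
pose I := map_poly (intr : int -> rat).
have sI G : size (I G) = size G by exact: size_rat_int_poly.
have IP0 : I P != 0 by rewrite -size_poly_eq0 sI size_poly_eq0.
have MQ0 : M%:R != 0 :> rat by rewrite pnatr_eq0 -lt0n.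
(* Coordinates of [F]: the one along [Q] is reduced modulo [P]. *)
have [alpha [beta [Fab sa sb]]] : exists alpha beta : {poly rat},
    [/\ I F = alpha * I P + beta * I Q,
        (size (alpha * I P)%R <= n.+1)%N & (size beta <= m)%N].
  have /Bezout_coprimepP[[u v] /= uv] := copPQ.
  have [c c0 uvc] := size_poly1P _ (introT eqP (etrans (eqp_size uv) (size_poly1 _))).
  have cQ0 : c%:~R != 0 :> rat by rewrite intr_eq0.
  have bez : I u * I P + I v * I Q = (c%:~R)%:P.
    by rewrite -!rmorphM -rmorphD uvc /= map_polyC.
  pose f := c%:~R^-1 *: I F.
  have sB : (size ((f * I v) %% I P)%R <= m)%N.
    by rewrite -ltnS (leq_trans _ sP) // -(sI P) ltn_modp.
  have FE : I F = (f * I u + (f * I v) %/ I P * I Q) * I P + (f * I v) %% I P * I Q.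
    rewrite mulrDl addrAC -!mulrA [I Q * I P]mulrC -addrA -[X in _ + X]addrC.
    rewrite !mulrA -mulrDl -divp_eq -!mulrA -mulrDr bez mulrC mul_polyC.
    by rewrite scalerA divff // scale1r.
  exists (f * I u + (f * I v) %/ I P * I Q), ((f * I v) %% I P); split=> //.
  rewrite -(addrK ((f * I v) %% I P * I Q) (_ * I P)) -FE.
  rewrite (leq_trans (size_polyD _ _)) // size_polyN geq_max sI sF /=.
  apply: leq_trans (size_polyMleq _ _) _; rewrite sI; move: sB sQ mn.
  set x := size _; set y := size _; lia.
pose rnd (g : {poly rat}) : {poly int} := \poly_(i < size g) Num.floor (g`_i / M%:R).
have rndP g i : `|(g - M%:R *: I (rnd g))`_i| <= M%:R.
  rewrite coefB coefZ /I coef_map /= coef_poly; case: ltnP => [_|gi]; last first.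
    by rewrite nth_default // rmorph0 mulr0 subrr normr0.
  have /andP[le1 lt1] := floor_itv (g`_i / M%:R).
  have MQ_gt0 : 0 < M%:R :> rat by rewrite ltr0n.
  set x := g`_i / M%:R in le1 lt1 *; have -> : g`_i = M%:R * x by rewrite mulrC divfK.
  rewrite -mulrBr normrM normr_nat ler_piMr // ger0_norm ?subr_ge0 //.
  by move: lt1; rewrite intrD; lra.
have srnd g : (size (rnd g) <= size g)%N by exact: size_poly.
have srnd' g : (size (g - M%:R *: I (rnd g))%R <= size g)%N.
  rewrite (leq_trans (size_polyD _ _)) // size_polyN geq_max leqnn /=.
  by rewrite (leq_trans (size_scale_leq _ _)) // sI.
have s_alpha : ((size alpha + size P).-1 <= n.+1)%N.
  have [->|a0] := eqVneq alpha 0; first by rewrite size_poly0 add0n; lia.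
  by rewrite -(sI P) -size_mul.
exists (rnd alpha), (rnd beta); move=> r; split.
  rewrite (leq_trans (size_polyD _ _)) // size_polyN geq_max sF /=.
  rewrite (leq_trans (size_scale_leq _ _)) // (leq_trans (size_polyD _ _)) // geq_max.
  have := srnd alpha; have := srnd beta => h1 h2; apply/andP; split.
    apply: leq_trans (size_polyMleq _ _) (leq_trans _ s_alpha).
    by rewrite -!subn1 leq_sub2r // leq_add2r.
  apply: leq_trans (size_polyMleq _ _) _; move: h1 sb sQ mn.
  by set x := size (rnd _); set y := size Q; set z := size beta; lia.
have rE : I r = (alpha - M%:R *: I (rnd alpha)) * I P + (beta - M%:R *: I (rnd beta)) * I Q.
  rewrite /r /I rmorphB /= -/(I F) Fab map_polyZ /= rmorphD !rmorphM /= -pmulrn.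
  by rewrite -!mul_polyC; ring.
have sa' : (size alpha <= n.+1)%N.
  by apply: leq_trans s_alpha; have := size_poly_gt0 P; rewrite P0; lia.
have sb' : (size beta <= n.+1)%N by lia.
apply: height_leP => i; rewrite -(ler_nat rat).
have -> : `|(r`_i)%R|%N%:R = `|(I r)`_i| by rewrite /I coef_map /= -intr_norm -pmulrn natr_absz.
rewrite rE coefD (le_trans (ler_normD _ _)) // mul2n -addnn natrD lerD //.
  by apply: coefM_norm_le => //; exact: leq_trans (srnd' _) _.
by apply: coefM_norm_le => //; exact: leq_trans (srnd' _) _.
Qed.

End Rounding.

(** * Eisenstein polynomials with small value and unit derivative *)

Definition eisenstein (q : nat) (F : {poly int}) : Prop :=
  [/\ ~~ (q %| lead_coef F)%Z, ~~ (q%:Z ^+ 2 %| F`_0)%Z &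
      forall i, (i < (size F).-1)%N -> (q %| F`_i)%Z].

Section Construction.
Variables (R : realType) (p : nat) (p_pr : prime p) (xi : padic p_pr).
Local Notation Qp := (padic p_pr).
Local Notation "`[ x ]" := (padic_abs R x) (at level 0, format "`[ x ]").
Hypothesis xi_int : `[xi] <= 1.
Variables (q : nat) (q_pr : prime q).
Hypothesis q_neq_p : q != p.
Implicit Types (P Q A B F : {poly int}).

Let p_gt0 : 0 < p%:R :> R. Proof. by rewrite ltr0n prime_gt0. Qed.

Let coprime_pq : coprime p (q ^ 2).
Proof. by rewrite coprimeXr // prime_coprime // dvdn_prime2 // eq_sym. Qed.

Let abs_q2 : `[(q ^ 2)%N%:Z%:~R : Qp] = 1.
Proof. by apply: padic_abs_coprime; rewrite -prime_coprime. Qed.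

(** Of the choices [0] and [q ^ 2], which differ by a [p]-adic unit, at most one can
    make the sum a non-unit. *)
Lemma unit_derivative N : exists2 a1 : int, ((q ^ 2)%N%:Z %| a1)%Z &
  `[xi ^+ N.-1 *+ N + a1%:~R] = 1.
Proof.
set d := _ *+ N; have : `[d] <= 1.
  rewrite /d -mulr_natr padic_absM_le1 ?padic_absX ?exprn_ile1 ?padic_abs_ge0 //.
  exact: (padic_abs_int_le1 R p_pr N).
rewrite le_eqVlt => /orP[/eqP d1|d1]; first by exists 0; rewrite ?dvdz0 // addr0.
by exists (q ^ 2)%N%:Z => //; rewrite padic_absD_eq abs_q2.
Qed.

(** The constant coefficient is prescribed both [p]-adically, to make the value at
    [xi] small, and modulo [q ^ 2], for Eisenstein's criterion. *)
Lemma constant_coefficient (x : Qp) k : `[x] <= 1 ->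
  exists2 a0 : int, `[x + a0%:~R] <= p%:R ^- k & ((q ^ 2)%N%:Z %| a0 - q%:Z)%Z.
Proof.
rewrite -padic_absN => /(padic_int_approx k)[b xb].
have cop : coprimez (p ^ k)%N%:Z (q ^ 2)%N%:Z by rewrite coprimezE /= coprimeXl.
pose a0 := zchinese (p ^ k)%N%:Z (q ^ 2)%N%:Z b q%:Z.
exists a0; last by rewrite -eqz_mod_dvd; apply/eqP/zchinese_modr.
have : ((p ^ k)%N%:Z %| a0 - b)%Z by rewrite -eqz_mod_dvd; apply/eqP/zchinese_modl.
move=> /(padic_abs_dvd R p_pr) ab.
rewrite (_ : _ + _ = (a0 - b)%:~R - (- x - b%:~R)); first exact: padic_absB_le.
by rewrite rmorphB /=; ring.
Qed.

(** Perturbing ['X^N + a1 'X + a0] by [p * q ^ 2] times a combination of the small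
    polynomials [P] and [Q] changes neither the shape modulo [q ^ 2] nor the
    derivative modulo [p], and brings the height down to the size of [P] and [Q]. *)
Lemma eisenstein_small_value m n N X P Q (e : R) :
  0 < e -> (0 < X)%N -> (1 < n)%N -> (n <= N <= n.+1)%N ->
  (m.*2 <= n.+1)%N -> coprimep P Q -> P != 0 -> Q != 0 ->
  (size P <= m.+1)%N -> (size Q <= m.+1)%N ->
  (poly_height P <= X)%N -> (poly_height Q <= X)%N ->
  `[zeval P xi] <= e -> `[zeval Q xi] <= e ->
  exists F, [/\ size F = N.+1, eisenstein q F, N = n.+1 -> F \is monic,
    (poly_height F <= (1 + 2 * (n.+1 * (p * q ^ 2))) * X)%N &
    `[zeval F xi] <= e /\ `[zeval F^`() xi] = 1].
Proof.
move=> e0 X0 n1 /andP[nN Nn] mn copPQ P0 Q0 sP sQ hP hQ Pe Qe.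
have [a1 q_a1 d1] := unit_derivative N.
have [k ke] : exists k, p%:R ^- k <= e.
  have : (fun k => p%:R^-1 ^+ k) @ \oo --> (0 : R).
    by apply: cvg_expr; rewrite normfV ger0_norm // invf_lt1 // ltr1n prime_gt1.
  move=> /cvgrPdist_lt/(_ e e0)[k _ /(_ k (leqnn k))] /=.
  rewrite sub0r normrN ger0_norm ?exprn_ge0 ?invr_ge0 // exprVn => /ltW.
  by exists k.
have [a0 a0_small q_a0] : exists2 a0 : int,
    `[xi ^+ N + a1%:~R * xi + a0%:~R] <= p%:R ^- k & ((q ^ 2)%N%:Z %| a0 - q%:Z)%Z.
  apply: constant_coefficient; apply: padic_absD_le; last first.
    by apply: padic_absM_le1 => //; exact: padic_abs_int_le1.
  by rewrite padic_absX exprn_ile1 ?padic_abs_ge0.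
pose M := (p * q ^ 2)%N.
have M0 : (0 < M)%N by rewrite muln_gt0 expn_gt0 !prime_gt0.
pose G := a1 *: 'X + a0%:P : {poly int}.
have sG : (size G <= n.+1)%N.
  rewrite (leq_trans (size_polyD _ _)) // geq_max (leq_trans (size_scale_leq _ _)) ?size_polyX //=.
    by rewrite (leq_trans (size_polyC_leq1 _)).
  exact: ltnW.
have [A [B [sr hr]]] := small_representative M0 mn copPQ P0 Q0 sP sQ hP hQ sG.
set L := A * P + B * Q in sr hr; set r := G - _ in sr hr.
pose F := 'X^N + r.
have Fcoef i : F`_i = (i == N)%:R + ((if i == 1%N then a1 else 0) + (if i == 0%N then a0 else 0)
    - M%:Z * L`_i).
  rewrite /F /r /G coefD coefXn coefB coefD coefZ coefX coefC coefZ.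
  by case: (i == 1%N); rewrite ?mulr1 ?mulr0.
have q1 := prime_gt1 q_pr.
have q2_M : ((q ^ 2)%N%:Z %| M%:Z)%Z by rewrite dvdzE /= dvdn_mull.
have q_q2 : (q%:Z %| (q ^ 2)%N%:Z)%Z by rewrite dvdzE /= dvdn_exp.
have q_M := dvdz_trans q_q2 q2_M.
have q_a0' : (q%:Z %| a0)%Z.
  by rewrite -(subrK q%:Z a0) rpredD ?(dvdz_trans q_q2 q_a0) ?dvdzz.
have N1 : (1 < N)%N by exact: leq_trans nN.
have FN : ~~ (q%:Z %| F`_N)%Z.
  rewrite Fcoef eqxx !gtn_eqF ?(ltnW N1) // addr0 add0r.
  rewrite rpredBr; last by rewrite dvdz_mulr.
  by rewrite dvdzE /= dvdn1 gtn_eqF.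
have sF : size F = N.+1.
  apply/eqP; rewrite eqn_leq; apply/andP; split.
    by rewrite (leq_trans (size_polyD _ _)) // geq_max size_polyXn leqnn (leq_trans sr).
  rewrite ltnNge; apply/negP => sFN; move: FN; rewrite nth_default //.
  by rewrite dvdz0.
exists F; split=> //.
- split; rewrite ?sF /=.
  + by rewrite lead_coefE sF.
  + rewrite Fcoef (@ltn_eqF 0) ?(ltnW N1) //= !add0r.
    rewrite rpredBr; last by rewrite dvdz_mulr // -natrX.
    rewrite -(subrK q%:Z a0) rpredDl ?(dvdzE, abszX) /=.
      by rewrite -[X in (_ %| X)%N]expn1 dvdn_Pexp2l.
    by move: q_a0; rewrite dvdzE.
  + move=> i iN; rewrite Fcoef ltn_eqF // add0r rpredB ?dvdz_mulr //.
    by rewrite rpredD //; case: ifP; rewrite ?dvdz0 // (dvdz_trans q_q2 q_a1).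
- move=> NE; apply/monicP; rewrite lead_coefE sF /F coefD coefXn eqxx.
  by rewrite [r`__]nth_default ?addr0 // NE.
- have hXN : (poly_height 'X^N <= 1)%N by apply: height_leP => i; rewrite coefXn; case: (i == N).
  apply: leq_trans (heightD _ _) _; rewrite mulnDl mul1n leq_add //.
    exact: leq_trans X0.
  by apply: leq_trans hr _; rewrite -!mulnA.
have L_le : `[zeval L xi] <= e.
  rewrite /L !zevalE padic_absD_le // padic_absM.
    by apply: le_trans Pe; apply: ler_piMl; [exact: padic_abs_ge0 | exact: zeval_le1].
  by apply: le_trans Qe; apply: ler_piMl; [exact: padic_abs_ge0 | exact: zeval_le1].
clearbody L; split.
  rewrite /F /r /G !zevalE [X in `[X]](_ : _ =
     xi ^+ N + a1%:~R * xi + a0%:~R - M%:Z%:~R * zeval L xi); last by ring.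
  apply: padic_absB_le; first exact: le_trans ke.
  by rewrite padic_absM (le_trans _ L_le) // ler_piMl ?padic_abs_ge0 ?padic_abs_int_le1.
rewrite /F /r /G !(derivD, derivN, derivZ, derivX, derivC, derivXn) !zevalE.
have -> : zeval ('X^(N.-1) *+ N) xi = xi ^+ N.-1 *+ N 
  by rewrite /zeval !rmorphMn hornerMn -/(zeval _ _) zevalXn.
rewrite mulr1z mulr0z mulr1 addr0 addrA addrC padic_absD_eq d1 // padic_absN padic_absM.
apply: (@le_lt_trans _ _ (p%:R^-1)); last by rewrite invf_lt1 // ltr1n prime_gt1.
have -> : `[M%:Z%:~R : Qp] = p%:R^-1.
  by rewrite /M PoszM rmorphM padic_absM padic_abs_p abs_q2 mulr1.
apply: ler_piMr; first by rewrite invr_ge0 ltW.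
exact: zeval_le1.
Qed.

End Construction.

(** * Degree and height of the roots, and the approximation theorem *)

Section AlgebraicData.
Variables (p : nat) (p_pr : prime p) (q : nat) (q_pr : prime q).
Local Notation Qp := (padic p_pr).
Implicit Types (F G : {poly int}) (alpha : Qp).

Lemma map_poly_padic_rat F :
  map_poly (padic_rat p_pr) (map_poly intr F) = map_poly intr F.
Proof.
by rewrite -map_poly_comp; apply: eq_map_poly => a /=; rewrite rmorph_int.
Qed.

(** Being irreducible over the rationals, [F] is a constant multiple of both minimal
    polynomials of [alpha]; the constant is an integer for the primitive one, which
    therefore has the smaller height. *)
Lemma eisenstein_root F alpha N : size F = N.+1 -> (0 < N)%N -> eisenstein q F ->
  zeval F alpha = 0 ->
  [/\ algebraicOver (padic_rat p_pr) alpha, alg_degree alpha = N &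
      (0 < alg_height alpha <= poly_height F)%N].
Proof.
move=> sF N0 [lF F0 Fi] Fa.
have F_neq0 : F != 0 by rewrite -size_poly_eq0 sF.
have [_ irrF] : irreducible_poly (map_poly intr F : {poly rat}).
  by apply/irreducible_rat_int; apply: (@eisenstein_crit q) => //; rewrite sF; lia.
have rF : root (map_poly (padic_rat p_pr) (map_poly intr F)) alpha.
  by rewrite map_poly_padic_rat; apply/eqP.
have alg : algebraicOver (padic_rat p_pr) alpha.
  by exists (map_poly intr F) => //; rewrite -size_poly_eq0 size_rat_int_poly sF.
have [mon minP] := minPolyQP alg.
have sm : size (minPolyQ alpha) != 1%N.
  apply/negP => /size_poly1P[c c0 mE].
  have := minP (minPolyQ alpha); rewrite dvdpp mE map_polyC rootC /=.
  by rewrite fmorph_eq0 (negPf c0).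
have mF : minPolyQ alpha %= map_poly intr F by apply: irrF => //; rewrite -minP.
split=> //; first by rewrite /alg_degree (eqp_size mF) size_rat_int_poly sF.
have [cG GE] := minPolyZP alg.
rewrite /alg_height; set G := minPolyZ alpha in cG GE *.
have G0 : G != 0 by rewrite -zcontents_eq0 cG.
rewrite height_gt0 G0 /=.
have : G %| F by rewrite -dvdp_rat_int (eqp_dvdl _ (eqp_trans GE mF)) dvdpp.
case/dvdpP_int => r FE.
have GP : zprimitive G = G by rewrite [RHS]zpolyEprim cG scale1r.
have sr : size r = 1%N.
  have r0 : r != 0 by apply: contraNneq F_neq0 => r0; rewrite FE r0 mulr0.
  have sG : size G = N.+1.
    by rewrite -size_rat_int_poly (eqp_size (eqp_trans GE mF)) size_rat_int_poly.
  have sGr : size F = (size G + size r).-1 by rewrite {1}FE GP size_mul.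
  by move: sGr; rewrite sF sG addSn /= -addn1 => /addnI.
have [c c0 rE] := size_poly1P _ (introT eqP sr).
by rewrite FE GP rE mulrC mul_polyC heightZ // leq_pmull // absz_gt0.
Qed.

(** Encodes [F (c x)], whose roots are the roots of [F] divided by [c]. *)
Definition dilate (c : nat) F : {poly int} := \poly_(i < size F) (F`_i * c%:Z ^+ i).

Lemma dilate_lead c F : (0 < c)%N -> F != 0 -> F`_(size F).-1 * c%:Z ^+ (size F).-1 != 0.
Proof.
move=> c0 F0; rewrite mulf_neq0 // ?lead_coef_eq0 // -?lead_coefE ?lead_coef_eq0 //.
by rewrite expf_neq0 // eqz_nat -lt0n.
Qed.

Lemma size_dilate c F : (0 < c)%N -> size (dilate c F) = size F.
Proof.
move=> c0; have [->|F0] := eqVneq F 0; last by rewrite size_poly_eq ?dilate_lead.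
by rewrite /dilate size_poly0 poly_def big_ord0 size_poly0.
Qed.

Lemma zeval_wide s F (x : Qp) : (size F <= s)%N ->
  zeval F x = \sum_(i < s) (F`_i)%:~R * x ^+ i.
Proof.
move=> sF; rewrite /zeval (@horner_coef_wide _ s); last exact: leq_trans (size_poly _ _) sF.
by apply: eq_bigr => i _; rewrite coef_map.
Qed.

Lemma zeval_dilate c F (x : Qp) : zeval (dilate c F) x = zeval F (c%:R * x).
Proof.
rewrite !(@zeval_wide (size F)) ?size_poly //; apply: eq_bigr => i _.
by rewrite coef_poly ltn_ord rmorphM rmorphXn /= exprMn mulrA -pmulrn.
Qed.

Lemma height_dilate c F N : (0 < c)%N -> (size F <= N.+1)%N ->
  (poly_height (dilate c F) <= c ^ N * poly_height F)%N.
Proof.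
move=> c0 sF; apply: height_leP => i; rewrite coef_poly.
case: ltnP => [iF|_] //; rewrite abszM abszX absz_nat mulnC leq_mul ?coef_le_height //.
by rewrite leq_pexp2l // -ltnS (leq_trans iF).
Qed.

Lemma eisenstein_dilate c F : (0 < c)%N -> coprime q c -> F != 0 -> eisenstein q F ->
  eisenstein q (dilate c F).
Proof.
move=> c0 qc F0 [lF Fc Fi]; split.
- rewrite /dilate lead_coef_poly ?size_poly_gt0 ?dilate_lead // -lead_coefE.
  rewrite Gauss_dvdzl // coprimezE abszX absz_nat.
  exact: coprimeXr.
- by rewrite coef_poly size_poly_gt0 F0 expr0 mulr1.
- move=> i; rewrite size_dilate // coef_poly => iF.
  by case: ifP => _; rewrite ?dvdz0 // dvdz_mulr // Fi.
Qed.

End AlgebraicData.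

Section Approximation.
Variables (R : realType) (p : nat) (p_pr : prime p).
Local Notation Qp := (padic p_pr).
Local Notation "`[ x ]" := (padic_abs R x) (at level 0, format "`[ x ]").

Lemma zeval_transc (xi : Qp) : ~ algebraicOver (padic_rat p_pr) xi ->
  forall F : {poly int}, F != 0 -> zeval F xi != 0.
Proof.
move=> xi_transc F F0; apply/negP => /eqP Fxi; apply: xi_transc.
exists (map_poly intr F); first by rewrite -size_poly_eq0 size_rat_int_poly size_poly_eq0.
by rewrite map_poly_padic_rat; apply/eqP.
Qed.

(** The loss in height from [X] to the height of [F] is the constant factor [D], so the
    quality [X ^- w] of the coprime pair passes to the root found by Hensel's lemma. *)
Lemma integral_approximation (xi : Qp) (q n N : nat) :
  `[xi] <= 1 -> (forall F : {poly int}, F != 0 -> zeval F xi != 0) ->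
  prime q -> q != p -> (1 < n)%N -> (n <= N <= n.+1)%N ->
  exists2 C : R, 0 < C & forall e : R, 0 < e -> exists (F : {poly int}) (alpha : Qp),
    [/\ size F = N.+1, eisenstein q F, N = n.+1 -> F \is monic, zeval F alpha = 0 &
        `[xi - alpha] < e /\ `[xi - alpha] * (poly_height F)%:R ^+ (uphalf n).+1 <= C].
Proof.
move=> xi_int xi_transc q_pr qp n1 nN.
pose m := uphalf n.
have m0 : (0 < m)%N by rewrite uphalf_gt0 ltnW.
have mn : (m.*2 <= n.+1)%N by rewrite /m uphalf_half; have := odd_double_half n; lia.
have [K0 goodK] := coprime_good_pair xi_int xi_transc m0.
pose K := Num.max 1 K0; have K_gt0 : 0 < K by rewrite lt_max ltr01.
pose D := (1 + 2 * (n.+1 * (p * q ^ 2)))%N.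
exists (K * D%:R ^+ m.+1) => [|e e0]; first by rewrite mulr_gt0 // exprn_gt0 // ltr0n.
pose e' := Num.min 1 e; have e'0 : 0 < e' by rewrite lt_min ltr01.
have [X [P [Q [NX [copPQ [P0 Q0]] [sP sQ] [hP hQ] [VP VQ]]]]] :=
  goodK (Num.truncn (K / e')).+1.
have X0 : (0 < X)%N by exact: leq_trans NX.
have XR0 : 0 < X%:R :> R by rewrite ltr0n.
have Xw0 : 0 < X%:R ^+ m.+1 :> R by rewrite exprn_gt0.
pose d := K / X%:R ^+ m.+1; have d0 : 0 < d by rewrite divr_gt0.
have de : d < e'.
  rewrite ltr_pdivrMr // mulrC -ltr_pdivrMr //.
  apply: (@lt_le_trans _ _ X%:R).
    by apply: lt_le_trans (truncnS_gt _) _; rewrite ?num_real // ler_nat.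
  by rewrite -[X in X <= _]expr1 ler_weXn2l // ler1n.
have Pd : `[zeval P xi] <= d by rewrite ler_pdivlMr // (le_trans VP) // le_max lexx orbT.
have Qd : `[zeval Q xi] <= d by rewrite ler_pdivlMr // (le_trans VQ) // le_max lexx orbT.
have [F [sF eisF monF hF [Fd dF]]] := eisenstein_small_value xi_int q_pr qp d0 X0 n1 nN
  mn copPQ P0 Q0 sP sQ hP hQ Pd Qd.
have F1 : `[zeval F xi] < 1.
  by apply: le_lt_trans Fd (lt_le_trans de _); rewrite ge_min lexx.
have [alpha Fa xia] := hensel xi_int dF F1.
exists F, alpha; split=> //; split.
  by apply: le_lt_trans xia (le_lt_trans Fd (lt_le_trans de _)); rewrite ge_min lexx orbT.
apply: (@le_trans _ _ (d * (D * X)%:R ^+ m.+1)).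
  apply: ler_pM; rewrite ?padic_abs_ge0 ?exprn_ge0 //; first exact: le_trans Fd.
  by rewrite lerXn2r ?nnegrE // ler_nat.
by rewrite natrM exprMn mulrCA divfK ?gt_eqF // mulrC.
Qed.

(** Finitely many points other than [xi] stay at a positive distance from it. *)
Lemma infinite_near (xi : Qp) (S : set Qp) : ~ S xi ->
  (forall e : R, 0 < e -> exists2 alpha, S alpha & `[xi - alpha] < e) -> infinite_set S.
Proof.
move=> Sxi Snear /finite_seqP[s Ss].
have [e e0 es] : exists2 e : R, 0 < e & forall a, a \in s -> e <= `[xi - a].
  have : xi \notin s by apply/negP => xis; apply: Sxi; rewrite Ss.
  elim: s {Ss} => [|a s IH] /=; first by exists 1.
  rewrite inE negb_or => /andP[xia /IH[e e0 es]].
  exists (Num.min e `[xi - a]).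
    by rewrite lt_min e0 padic_abs_gt0 subr_eq0.
  by move=> b; rewrite inE => /predU1P[->|/es eb]; rewrite ge_min ?lexx ?orbT ?eb.
have [a Sa ae] := Snear e e0.
by have := es a; rewrite leNgt ae => /(_ _)/negP; apply=> //; rewrite Ss in Sa.
Qed.

Lemma height_bound_inv (x c h : R) (k : nat) (H : nat) : 0 <= x -> (0 < H)%N ->
  H%:R <= h -> x * h ^+ k <= c -> x <= c * H%:R ^- k.
Proof.
move=> x0 H0 Hh xc; rewrite ler_pdivlMr ?exprn_gt0 ?ltr0n //.
by apply: le_trans xc; rewrite ler_wpM2l // lerXn2r ?nnegrE // (le_trans _ Hh).
Qed.

Lemma auxiliary_prime : exists2 q, prime q & q != p.
Proof. by have [->|p2] := eqVneq p 2; [exists 3 | exists 2; rewrite // eq_sym]. Qed.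

(** The approximations of [p ^ j * xi], which is a [p]-adic integer for large [j], are
    divided by [p ^ j]; this changes heights and distances by bounded factors. *)
Lemma algebraic_numbers_degree_n (xi : Qp) n : ~ algebraicOver (padic_rat p_pr) xi -> (1 < n)%N ->
  exists2 c : R, 0 < c & infinite_set [set alpha : Qp |
    [/\ algebraicOver (padic_rat p_pr) alpha, alg_degree alpha = n &
        `[xi - alpha] <= c * (alg_height alpha)%:R ^- (uphalf n + 1)]].
Proof.
move=> xi_transc n1.
have [q q_pr qp] := auxiliary_prime.
have p_gt0 : 0 < p%:R :> R by rewrite ltr0n prime_gt0.
have abs_p : `[p%:R : Qp] = p%:R^-1 by rewrite -(padic_abs_p R p_pr).
have [c [c0 qc abs_c xic]] : exists c : nat,
    [/\ (0 < c)%N, coprime q c, `[c%:R : Qp] = c%:R^-1 & `[c%:R * xi] <= 1].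
  pose j := (Num.truncn `[xi]).+1.
  have abs_pj : `[(p ^ j)%N%:R : Qp] = (p ^ j)%N%:R^-1.
    by rewrite !natrX padic_absX abs_p exprVn.
  have pj0 : (0 < p ^ j)%N by rewrite expn_gt0 prime_gt0.
  exists (p ^ j)%N; split=> //.
    by rewrite coprimeXr // prime_coprime // dvdn_prime2.
  rewrite padic_absM abs_pj mulrC ler_pdivrMr ?ltr0n // mul1r.
  apply: (@le_trans _ _ j%:R); first by rewrite ltW // truncnS_gt // num_real.
  by rewrite ler_nat ltnW // ltn_expl // prime_gt1.
have cQ0 : c%:R != 0 :> Qp.
  by rewrite -(padic_abs_eq0 R) abs_c invr_neq0 // pnatr_eq0 -lt0n.
have cR0 : 0 < c%:R :> R by rewrite ltr0n.
have transc' : forall F : {poly int}, F != 0 -> zeval F (c%:R * xi) != 0.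
  move=> F F0; rewrite -zeval_dilate; apply: zeval_transc => //.
  by rewrite -size_poly_eq0 size_dilate // size_poly_eq0.
have nn : (n <= n <= n.+1)%N by rewrite leqnn leqnSn.
have [C C0 approx] := integral_approximation xic transc' q_pr qp n1 nn.
exists (c%:R * C * (c ^ n)%:R ^+ (uphalf n + 1)).
  by rewrite !mulr_gt0 // exprn_gt0 // ltr0n expn_gt0 c0.
apply: (@infinite_near xi) => [[]//|e e0].
have [F [alpha [sF eisF _ Fa [ae aC]]]] := approx (e / c%:R) (divr_gt0 e0 cR0).
have F0 : F != 0 by rewrite -size_poly_eq0 sF.
pose beta := alpha / c%:R.
have xib : `[xi - beta] = c%:R * `[c%:R * xi - alpha].
  rewrite -{1}[xi](mulKf cQ0) -/beta /beta mulrC -mulrBl padic_absM padic_absV abs_c invrK.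
  by rewrite mulrC.
have Fb : zeval (dilate c F) beta = 0 by rewrite zeval_dilate mulrC divfK.
have bound h : (0 < h)%N -> (h <= poly_height (dilate c F))%N ->
    `[xi - beta] <= c%:R * C * (c ^ n)%:R ^+ (uphalf n + 1) * h%:R ^- (uphalf n + 1).
  move=> h0 hF; have := padic_abs_ge0 R (c%:R * xi - alpha); rewrite xib addn1.
  move: aC; move: (padic_abs R _) => x xC x0.
  apply: (height_bound_inv (h := (c ^ n)%:R * (poly_height F)%:R) _ h0).
  - by rewrite mulr_ge0.
  - by rewrite -natrM ler_nat (leq_trans hF) // height_dilate // sF.
  - rewrite exprMn mulrACA [X in _ <= X]mulrAC; apply: ler_wpM2l xC.
    by rewrite mulr_ge0 ?exprn_ge0.
have [alg deg /andP[h0 hF]] := eisenstein_root q_pr (etrans (size_dilate F c0) sF)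
   (ltnW n1) (eisenstein_dilate c0 qc F0 eisF) Fb.
exists beta; first by split; [exact: alg | exact: deg | exact: bound].
by rewrite xib mulrC -ltr_pdivlMr.
Qed.

Lemma algebraic_integers_degree_Sn (xi : Qp) n : ~ algebraicOver (padic_rat p_pr) xi -> (1 < n)%N ->
  exists2 c : R, 0 < c & (`[xi] <= 1 -> infinite_set [set alpha : Qp |
    [/\ algebraicOver (padic_rat p_pr) alpha,
        integralOver (intr : int -> Qp) alpha, alg_degree alpha = n.+1 &
        `[xi - alpha] <= c * (alg_height alpha)%:R ^- (uphalf n + 1)]]).
Proof.
move=> xi_transc n1; have [xi_int|] := boolP (`[xi] <= 1); last by exists 1.
have [q q_pr qp] := auxiliary_prime.
have nn : (n <= n.+1 <= n.+1)%N by rewrite leqnn leqnSn.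
have [C C0 approx] := integral_approximation xi_int (zeval_transc xi_transc) q_pr qp n1 nn.
exists C => // _; apply: (@infinite_near xi) => [[]//|e e0].
have [F [alpha [sF eisF monF Fa [ae aC]]]] := approx e e0.
have [alg deg /andP[h0 hF]] := eisenstein_root q_pr sF isT eisF Fa.
exists alpha; last exact: ae.
split; [exact: alg | | exact: deg |].
  by exists F; [exact: monF | apply/eqP].
rewrite addn1.
apply: (height_bound_inv (padic_abs_ge0 R _) h0 _ aC).
by rewrite ler_nat; exact: hF.
Qed.

End Approximation.

Theorem mainTheorem9 (R : realType) (p : nat) (p_pr : prime p)
    (xi : padic p_pr) (n : nat)
    (xi_transc : ~ algebraicOver (padic_rat p_pr) xi)
    (n_ge2 : (2 <= n)%N) :
  exists2 c : R, 0 < c &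
    infinite_set [set alpha : padic p_pr |
      [/\ algebraicOver (padic_rat p_pr) alpha,
          alg_degree alpha = n &
          padic_abs R (xi - alpha)
            <= c * (alg_height alpha)%:R ^- (uphalf n + 1)]]
    /\
    (padic_abs R xi = 1 ->
     infinite_set [set alpha : padic p_pr |
      [/\ algebraicOver (padic_rat p_pr) alpha,
          integralOver (intr : int -> padic p_pr) alpha,
          alg_degree alpha = n.+1 &
          padic_abs R (xi - alpha)
            <= c * (alg_height alpha)%:R ^- (uphalf n + 1)]]).
Proof.
have [c1 c1_gt0 inf1] := algebraic_numbers_degree_n R xi_transc n_ge2.
have [c2 _ inf2] := algebraic_integers_degree_Sn R xi_transc n_ge2.
have le_max_c (c : R) (h : nat) (x : R) : c <= Num.max c1 c2 ->
    x <= c * h%:R ^- (uphalf n + 1) -> x <= Num.max c1 c2 * h%:R ^- (uphalf n + 1).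
  by move=> cc /le_trans; apply; rewrite ler_wpM2r // invr_ge0 exprn_ge0.
exists (Num.max c1 c2); first by rewrite lt_max c1_gt0.
split=> [|xi1].
  apply: sub_infinite_set inf1 => alpha [alg deg].
  move=> /le_max_c h; split; [exact: alg | exact: deg |].
  by apply: h; rewrite le_max lexx.
apply: sub_infinite_set (inf2 _); last by rewrite xi1.
move=> alpha [alg int deg] /le_max_c h; split; [exact: alg | exact: int | exact: deg |].
by apply: h; rewrite le_max lexx orbT.
Qed.
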